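(* Assume $X$ has finite variation, i.e. $\sigma=0$ and $\int_{|x|\le1}|x|\nu(dx)<\infty$, and that $d_+>0$. Then $$\lim_{t\to T}\frac{1}{T-t}\Big(\frac{K}{b_e(t)}-1\Big)=\int(e^y-1)_-\,\nu(dy).$$
   Context: Let $X$ be a real Lévy process with characteristic triplet $(\sigma^2,\gamma,\nu)$. Fix $T>0$, $K>0$, $r>0$, $\delta\ge0$. Assume $\int_{|x|\ge1}e^x\nu(dx)<\infty$ and $\frac{\sigma^2}{2}+\gamma+\int(e^x-1-x\mathbf 1_{|x|\le1})\nu(dx)=0$, and the non-degeneracy condition: $\sigma\neq0$, or $\nu((-\infty,0))>0$, or $\int_{(0,\infty)}(x\wedge1)\nu(dx)=\infty$. For $x\ge0$ let $S^x_t=xe^{(r-\delta)t+X_t}$ and $P_e(t,x)=\mathbb E[e^{-r(T-t)}(K-S^x_{T-t})_+]$ (European put). The European critical price is $b_e(t)=\inf\{x\ge0: P_e(t,x)>(K-x)_+\}$, $t\in[0,T)$; it is the unique $x\in(0,K)$ with $P_e(t,x)=K-x$. Let $d_+=r-\delta-\int(e^y-1)_+\nu(dy)$, and $(u)_-=\max(-u,0)$. *)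

(* Defs.v *)
From HB Require Import structures.
From mathcomp Require Import all_boot all_order all_algebra.
From mathcomp Require Import all_classical all_reals all_analysis.
Set Implicit Arguments. Unset Strict Implicit. Unset Printing Implicit Defensive.
Import Order.TTheory GRing.Theory Num.Theory.
Import numFieldNormedType.Exports.
Local Open Scope classical_set_scope.
Local Open Scope ring_scope.

Section Defs.
Context {R : realType}.

Definition posp (u : R) : R := Num.max u 0.
Definition negp (u : R) : R := Num.max (- u) 0.

Definition is_levy_measure (nu : {measure set (measurableTypeR R) -> \bar R}) :=
  nu [set 0] = 0%E /\
  nu.-integrable setT (fun x : measurableTypeR R => (Num.min (x ^+ 2) 1)%:E).

(* real and imaginary parts of the Levy exponent
   psi(u) = -sigma^2 u^2/2 + i gamma u + int (e^{iux} - 1 - iux 1_{|x|<=1}) nu(dx) *)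
Definition levy_re (sigma : R) (nu : {measure set (measurableTypeR R) -> \bar R})
  (u : R) : R :=
  - (sigma ^+ 2 * u ^+ 2) / 2 + \int[nu]_(x in setT) (cos (u * x) - 1).
Definition levy_im (gamma : R) (nu : {measure set (measurableTypeR R) -> \bar R})
  (u : R) : R :=
  gamma * u + \int[nu]_(x in setT) (sin (u * x) - (if `|x| <= 1 then u * x else 0)).

(* X = (X_t)_{t >= 0} on the probability space (Omega, P) is a Levy process with
   characteristic triplet (sigma^2, gamma, nu): each X_t is a random variable with
   E[exp(i u X_t)] = exp(t psi(u)), written via real and imaginary parts. *)
Definition levy_process {d : measure_display} {Omega : measurableType d}
  (P : probability Omega R) (X : R -> Omega -> R) (sigma gamma : R)
  (nu : {measure set (measurableTypeR R) -> \bar R}) :=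
  is_levy_measure nu /\
  forall t : R, 0 <= t ->
    measurable_fun setT (X t) /\
    forall u : R,
      \int[P]_(w in setT) cos (u * X t w)
        = expR (t * levy_re sigma nu u) * cos (t * levy_im gamma nu u) /\
      \int[P]_(w in setT) sin (u * X t w)
        = expR (t * levy_re sigma nu u) * sin (t * levy_im gamma nu u).

Definition euro_put {d : measure_display} {Omega : measurableType d}
  (P : probability Omega R) (X : R -> Omega -> R) (T K r delta : R) (t x : R) : R :=
  \int[P]_(w in setT)
     (expR (- r * (T - t)) * posp (K - x * expR ((r - delta) * (T - t) + X (T - t) w))).

Definition euro_crit {d : measure_display} {Omega : measurableType d}
  (P : probability Omega R) (X : R -> Omega -> R) (T K r delta : R) (t : R) : R :=
  inf [set x : R | 0 <= x /\ posp (K - x) < euro_put P X T K r delta t x].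

End Defs.

(* Main.v *)
Require Import Defs.
From HB Require Import structures.
From mathcomp Require Import all_boot all_order all_algebra.
From mathcomp Require Import all_classical all_reals all_analysis.
From mathcomp Require Import measurable_realfun ring lra.
Set Implicit Arguments. Unset Strict Implicit. Unset Printing Implicit Defensive.
Import Order.TTheory GRing.Theory Num.Theory.
Import numFieldNormedType.Exports.
Local Open Scope classical_set_scope.
Local Open Scope ring_scope.

(** Write [K / b_e = exp (c th)] with [th = T - t] and let [p x = (1 - e^x)_+].
The price equation compares [(1 - e^{-c th})] with [e^{-r th} E p(Y_th)], where
[Y_th = (r - delta - c) th + X_th] is a finite variation Levy process of drift
[beta = d_+ + lam - c] and [lam] is the claimed limit.  It is enough to know
that [E p(Y_th) / th --> lam] whenever [beta >= 0]: then [c th] lies below the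
critical exponent for [c < lam], and above it for [lam < c < lam + d_+], the
latter by convexity of the put price in the spot.

Only the characteristic function of [X_th] is given, so the limit is computed
by Fourier inversion.  Up to a constant factor, [2 p(x)] is the integral over
the line of [((1 - cos ux) - sin(ux) / u) / (1 + u^2)], which follows from
[int (1 - cos ux) / u^2 du = C |x|] by averaging [|x - k|] over [k] with
density [e^{-k}].  The even part carries the kink of [p]: there the drift
contributes [beta], seen on the scale [u ~ 1 / th].  The odd part is [C^1] and
contributes [- beta] by dominated convergence, so the drift cancels and the
jumps give [int p dnu = lam].  As [sin(ux) / u] is not integrable near [u = 0]
uniformly in large jumps, the odd part [s(x)] is replaced by
[s(x) - s(eta x)], at a cost which vanishes with [eta]. *)

(** * Measurability and dominated convergence for real integrals *)

Section measurability.
Context {d : measure_display} {T : measurableType d} {R : realType}.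
Implicit Types (D : set T) (f g : T -> R).

(** Since [0^-1 = 0], the inverse is [f] times the power [-1] of [f^2], and real powers are
    measurable. *)
Lemma measurable_funVr D f : measurable_fun D f ->
  measurable_fun D (fun x => (f x)^-1).
Proof.
move=> mf.
have -> : (fun x => (f x)^-1) = f \* (fun x => (f x ^+ 2) `^ (-1)).
  apply/funext => x /=; rewrite powR_inv1 ?sqr_ge0//.
  have [->|fx0] := eqVneq (f x) 0; first by rewrite invr0 mul0r.
  by rewrite expr2 invfM mulrA mulfV// mul1r.
apply: measurable_funM => //.
by apply: (measurableT_comp (measurable_powR _)); exact: measurable_funX.
Qed.

Lemma measurable_cos_comp D f : measurable_fun D f ->
  measurable_fun D (fun x => cos (f x)).
Proof.
by move=> mf; apply: (measurableT_comp (f := cos) _ mf);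
  apply: continuous_measurable_fun; exact: continuous_cos.
Qed.

Lemma measurable_sin_comp D f : measurable_fun D f ->
  measurable_fun D (fun x => sin (f x)).
Proof.
by move=> mf; apply: (measurableT_comp (f := sin) _ mf);
  apply: continuous_measurable_fun; exact: continuous_sin.
Qed.

Lemma measurable_expR_comp D f : measurable_fun D f ->
  measurable_fun D (fun x => expR (f x)).
Proof. exact: (measurableT_comp (@measurable_expR R)). Qed.

Lemma measurable_normr_comp D f : measurable_fun D f ->
  measurable_fun D (fun x => `|f x|).
Proof. by move=> mf; apply: (measurableT_comp (f := @Num.norm R R) _ mf). Qed.

Lemma measurable_addr D f g : measurable_fun D f -> measurable_fun D g ->
  measurable_fun D (fun x => f x + g x).
Proof. exact: measurable_funD. Qed.

Lemma measurable_oppr D f : measurable_fun D f ->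
  measurable_fun D (fun x => - f x).
Proof. exact: measurable_funN. Qed.

Lemma measurable_mulr D f g : measurable_fun D f -> measurable_fun D g ->
  measurable_fun D (fun x => f x * g x).
Proof. exact: measurable_funM. Qed.

Lemma measurable_exprn D f n : measurable_fun D f ->
  measurable_fun D (fun x => f x ^+ n).
Proof. exact: measurable_funX. Qed.

Lemma measurable_max_fun D f g : measurable_fun D f -> measurable_fun D g ->
  measurable_fun D (fun x => Num.max (f x) (g x)).
Proof. exact: measurable_maxr. Qed.

Lemma measurable_min_fun D f g : measurable_fun D f -> measurable_fun D g ->
  measurable_fun D (fun x => Num.min (f x) (g x)).
Proof. exact: measurable_minr. Qed.

End measurability.

(** The measurability lemmas are stated pointwise so that the head symbol of a goal selects one of
    them; what remains are the non-elementary atoms. *)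
Ltac measurability := repeat first
  [ assumption
  | exact: measurable_cst
  | exact: measurable_id
  | exact: measurable_fst
  | exact: measurable_snd
  | apply: measurable_addr
  | apply: measurable_oppr
  | apply: measurable_mulr
  | apply: measurable_exprn
  | apply: measurable_max_fun
  | apply: measurable_min_fun
  | apply: measurable_normr_comp
  | apply: measurable_expR_comp
  | apply: measurable_cos_comp
  | apply: measurable_sin_comp
  | apply: measurable_funVr ].

Section Rintegral_extra.
Context {d : measure_display} {T : measurableType d} {R : realType}.
Variable mu : {measure set T -> \bar R}.
Implicit Types f g : T -> R.

Lemma le_integrableR f g : measurable_fun setT f -> (forall x, `|f x| <= g x) ->
  mu.-integrable setT (EFin \o g) -> mu.-integrable setT (EFin \o f).
Proof.
move=> mf fg; apply: le_integrable => //; first exact/measurable_EFinP.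
by move=> x _ /=; rewrite lee_fin (le_trans (fg x))// ler_norm.
Qed.

Lemma integrableZlR (k : R) f : mu.-integrable setT (EFin \o f) ->
  mu.-integrable setT (EFin \o (fun x => k * f x)).
Proof.
move=> intf.
have -> : EFin \o (fun x => k * f x) = (fun x => k%:E * (EFin \o f) x)%E.
  by apply/funext => x /=; rewrite EFinM.
exact: integrableZl.
Qed.

Lemma integrableDR f g : mu.-integrable setT (EFin \o f) ->
  mu.-integrable setT (EFin \o g) ->
  mu.-integrable setT (EFin \o (fun x => f x + g x)).
Proof.
move=> intf intg.
have -> : EFin \o (fun x => f x + g x) = ((EFin \o f) \+ (EFin \o g))%E.
  by apply/funext => x /=; rewrite EFinD.
exact: integrableD.
Qed.

Lemma integrableBR f g : mu.-integrable setT (EFin \o f) ->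
  mu.-integrable setT (EFin \o g) ->
  mu.-integrable setT (EFin \o (fun x => f x - g x)).
Proof.
move=> intf intg.
have -> : EFin \o (fun x => f x - g x) = ((EFin \o f) \- (EFin \o g))%E.
  by apply/funext => x /=; rewrite EFinB.
exact: integrableB.
Qed.

Lemma integral_RintegralE f : mu.-integrable setT (EFin \o f) ->
  (\int[mu]_x (f x)%:E)%E = (\int[mu]_x f x)%:E.
Proof. by move=> intf; rewrite /Rintegral fineK//; exact: integrable_fin_num. Qed.

Lemma ge0_integrableR f : measurable_fun setT f -> (forall x, 0 <= f x) ->
  (\int[mu]_x (f x)%:E < +oo)%E -> mu.-integrable setT (EFin \o f).
Proof.
move=> mf f0 fy; apply/integrableP; split; first exact/measurable_EFinP.
by under eq_integral do rewrite /= ger0_norm//.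
Qed.

Lemma dominated_cvgR (f_ : nat -> T -> R) f g :
  (forall n, measurable_fun setT (f_ n)) ->
  (forall x, f_ n x @[n --> \oo] --> f x) ->
  mu.-integrable setT (EFin \o g) ->
  (forall n x, `|f_ n x| <= g x) ->
  \int[mu]_x f_ n x @[n --> \oo] --> \int[mu]_x f x.
Proof.
move=> mf_ f_f intg f_g.
have mf : measurable_fun setT f.
  by apply: (measurable_fun_cvg (h := f_)) => // x _; exact: f_f.
(* The bound by [g] passes to the limit, so [f] is integrable and [fine] commutes with the limit. *)
have intf : mu.-integrable setT (EFin \o f).
  apply: le_integrableR intg => // x.
  have : `|f_ n x| @[n --> \oo] --> `|f x| by apply: cvg_norm; exact: f_f.
  move=> cf; rewrite -(cvg_lim (@Rhausdorff R) cf).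
  apply: limr_le; first by apply/cvg_ex; eexists; exact: cf.
  by apply: nearW => n; exact: f_g.
apply: fine_cvg; rewrite fineK; last exact: integrable_fin_num.
apply: (@dominated_cvg _ _ _ mu setT measurableT (fun n x => (f_ n x)%:E)
  (EFin \o f) (EFin \o g)) => //.
- by move=> n; exact/measurable_EFinP.
- by move=> x _; apply/cvg_EFin; [exact: nearW|exact: f_f].
- by move=> n x _ /=; rewrite lee_fin.
Qed.

End Rintegral_extra.

(** * Bounds on sine and cosine *)

Section trigo_bounds.
Context {R : realType}.
Implicit Type x : R.

Lemma sin_le_normr x : `|sin x| <= `|x|.
Proof.
wlog x0 : x / 0 < x.
  move=> H; have [x0|x0|->] := ltgtP x 0; last by rewrite sin0.
  - by have := H (- x); rewrite sinN !normrN oppr_gt0; apply.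
  - exact: H.
have [c _] := @MVT R sin cos 0 x x0 (fun y _ => is_derive_sin y)
  (continuous_subspaceT (@continuous_sin R)).
rewrite sin0 !subr0 => ->.
by rewrite normrM -[leRHS]mul1r ler_wpM2r// cos_max.
Qed.

Lemma subr_cos_ge0 x : 0 <= 1 - cos x.
Proof. by rewrite subr_ge0 cos_le1. Qed.

Lemma subr_cosE x : 1 - cos x = 2 * sin (x / 2) ^+ 2.
Proof.
have {1}-> : x = (x / 2) *+ 2 by rewrite -mulr_natr divfK// pnatr_eq0.
rewrite cos_mulr2n sin2cos2; ring.
Qed.

Lemma subr_cos_le_sqr x : 1 - cos x <= x ^+ 2.
Proof.
rewrite subr_cosE; have := sin_le_normr (x / 2) => h.
have : sin (x / 2) ^+ 2 <= (x / 2) ^+ 2.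
  by rewrite -[leLHS]real_normK ?num_real// -[leRHS]real_normK ?num_real// lerXn2r ?nnegrE.
have := sqr_ge0 x; rewrite expr_div_n; lra.
Qed.

Lemma subr_cos_le_norm x : 1 - cos x <= `|x|.
Proof.
rewrite subr_cosE -real_normK ?num_real//.
have h := sin_le_normr (x / 2); have h1 := sin_max (x / 2).
have : `|sin (x / 2)| ^+ 2 <= `|sin (x / 2)|.
  by rewrite expr2 -[leRHS]mulr1 ler_wpM2l.
by move: h; rewrite normrM (@ger0_norm _ 2^-1)//; lra.
Qed.

Lemma subr_cos_le2 x : 1 - cos x <= 2.
Proof. by have := cos_geN1 x; lra. Qed.

End trigo_bounds.

(** * Lebesgue measure on the line *)

Section lebesgue_line.
Context {R : realType}.
Local Notation mu := (@lebesgue_measure R).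
Implicit Types (f : R -> R) (k : R).

Lemma integrable_oneDsqrV :
  mu.-integrable setT (EFin \o (fun u : R => (1 + u ^+ 2)^-1)).
Proof.
apply: ge0_integrableR; first by measurability.
  by move=> u; rewrite invr_ge0 addr_ge0// sqr_ge0.
rewrite (@ge0_symfun_integralT R (fun u => (1 + u ^+ 2)^-1)).
- by rewrite -set_itvcy (@integral0y_oneDsqr R) -EFinM ltry.
- by move=> u; rewrite invr_ge0 addr_ge0// sqr_ge0.
- exact: continuous_oneDsqrV.
- by move=> u /=; rewrite sqrrN.
Qed.

(** The majorant used for most Fourier integrands below. *)
Lemma le_oneDsqrV_integrable f k : measurable_fun setT f ->
  (forall u, `|f u| <= k * (1 + u ^+ 2)^-1) -> mu.-integrable setT (EFin \o f).
Proof.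
by move=> mf fk; apply: le_integrableR (integrableZlR k integrable_oneDsqrV).
Qed.

(** Lebesgue measure is [k] times its image under [u -> k u]: both agree on intervals, the preimage
    of []a, b]] having length [(b - a) / k]. *)
Lemma ge0_integral_scale f k : 0 < k -> measurable_fun setT f ->
  (forall u, 0 <= f u) ->
  (\int[mu]_u (f u)%:E = k%:E * \int[mu]_u (f (k * u))%:E)%E.
Proof.
move=> k0 mf f0.
have mk : measurable_fun setT ( *%R k : measurableTypeR R -> measurableTypeR R).
  by apply: mulrl_measurable.
rewrite (eq_measure_integral
  (mscale (NngNum (ltW k0)) (pushforward mu ( *%R k : _ -> measurableTypeR R)))).
  rewrite ge0_integral_mscale//=; first last.
  - by move=> x _; rewrite lee_fin.
  - exact/measurable_EFinP.
  congr (_ * _)%E; rewrite ge0_integral_pushforward//.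
  - exact/measurable_EFinP.
  - by move=> x _; rewrite lee_fin.
move=> A mA _; apply: lebesgue_measure_unique => // _ [[a b] _ <-].
transitivity (k%:E * mu `](k^-1 * a)%R, (k^-1 * b)%R])%E.
  rewrite !lebesgue_measure_itv/= !lte_fin ltr_pM2l ?invr_gt0//.
  case: ifPn => _; last by rewrite mule0.
  by rewrite -!EFinD -EFinM -mulrBr mulrA mulfV ?mul1r// gt_eqF.
congr (_ * mu _)%E.
by apply/seteqP; split => x /=; rewrite !in_itv/= ltr_pdivrMl// ler_pdivlMl.
Qed.

Lemma integrable_scale f k : 0 < k -> mu.-integrable setT (EFin \o f) ->
  mu.-integrable setT (EFin \o (fun u => f (k * u))).
Proof.
move=> k0 /integrableP[/measurable_EFinP mf fy]; apply/integrableP; split.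
  apply/measurable_EFinP; apply: (measurableT_comp mf).
  exact: (@mulrl_measurable R setT k).
have : (\int[mu]_x `|f x|%:E < +oo)%E by [].
rewrite (@ge0_integral_scale (fun u => `|f u|) k)//; last by measurability.
have I0 : (0 <= \int[mu]_x `|f (k * x)|%:E)%E.
  by apply: integral_ge0 => x _; rewrite lee_fin.
change ((k%:E * \int[mu]_x `|f (k * x)|%:E < +oo)%E ->
        (\int[mu]_x `|f (k * x)|%:E < +oo)%E).
move: I0; case: (\int[mu]_x `|f (k * x)|%:E)%E => [r _ _|_|].
- exact: ltry.
- by rewrite gt0_muley// lte_fin.
- by rewrite leeNy_eq.
Qed.

(** Writing [f = (f + |f|) - |f|] reduces the claim to nonnegative functions. *)
Lemma Rintegral_scale f k : 0 < k -> mu.-integrable setT (EFin \o f) ->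
  \int[mu]_u f u = k * \int[mu]_u f (k * u).
Proof.
move=> k0 intf.
have mf : measurable_fun setT f by have /integrableP[/measurable_EFinP] := intf.
have ge0 (g : R -> R) : measurable_fun setT g -> (forall u, 0 <= g u) ->
    mu.-integrable setT (EFin \o g) ->
    \int[mu]_u g u = k * \int[mu]_u g (k * u).
  move=> mg g0 intg; apply: EFin_inj.
  rewrite EFinM -!integral_RintegralE//; last exact: integrable_scale.
  exact: ge0_integral_scale.
have intn : mu.-integrable setT (EFin \o (fun u => `|f u|)).
  exact: (integrable_norm intf).
have mn : measurable_fun setT (fun u => `|f u|) by measurability.
have H := ge0 _ mn (fun u => normr_ge0 (f u)) intn.
have mD : measurable_fun setT (fun u => f u + `|f u|) by measurability.
have H' := ge0 (fun u => f u + `|f u|) mD _ (integrableDR intf intn).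
have pos u : 0 <= f u + `|f u| by rewrite -lerBlDl sub0r -normrN ler_norm.
have := H' pos; rewrite RintegralD// RintegralD//; first last.
  exact: (integrable_scale k0 intn).
  exact: (integrable_scale k0 intf).
by rewrite mulrDr H => /addIr.
Qed.

End lebesgue_line.

(** * Laplace integrals *)

Section laplace_integrals.
Context {R : realType}.
Local Notation mu := (@lebesgue_measure R).
Implicit Types (f F : R -> R) (a x u : R).

Lemma is_derive_continuous f F : (forall k : R, is_derive k (1 : R) F (f k)) ->
  continuous F.
Proof.
move=> dF k; apply/differentiable_continuous/derivable1_diffP.
exact: (@ex_derive _ _ _ _ _ _ _ (dF k)).
Qed.

Lemma integral_half_line f F a : (forall k, a <= k -> 0 <= f k) ->
  continuous f -> (forall k : R, is_derive k (1 : R) F (f k)) ->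
  F k @[k --> +oo] --> 0 ->
  (\int[mu]_(k in `[a, +oo[) (f k)%:E = (- F a)%:E)%E.
Proof.
move=> f0 cf dF F0; rewrite (ge0_continuous_FTC2y f0 _ F0) ?sub0e//.
- exact: continuous_subspaceT.
- exact/cvg_at_right_filter/(is_derive_continuous dF).
- by move=> k _; rewrite derive1E; exact: (@derive_val _ _ _ _ _ _ _ (dF k)).
Qed.

Lemma cvg_expR_bounded f (M : R) : (forall k, 0 <= k -> `|f k| <= M) ->
  f k * expR (- k) @[k --> +oo] --> 0.
Proof.
move=> fM.
have M0 : 0 <= M := le_trans (normr_ge0 _) (fM 0 (lexx 0)).
apply: (@squeeze_cvgr _ _ _ _ (fun k => - M * expR (- k))
  (fun k => M * expR (- k))); last 2 first.
- by rewrite -(mulr0 (- M)); apply: cvgM; [exact: cvg_cst|exact: cvgr_expR].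
- by rewrite -(mulr0 M); apply: cvgM; [exact: cvg_cst|exact: cvgr_expR].
near=> k; rewrite !ler_pM2r ?expR_gt0// -ler_norml fM//.
Unshelve. all: by end_near. Qed.

(** One factor [e^{-k/2}] keeps the affine term bounded, the other tends to 0. *)
Lemma cvg_affine_expR (b c : R) : (b + c * k) * expR (- k) @[k --> +oo] --> 0.
Proof.
have h : (((b + c * k) * expR (- (k / 2))) * expR (- (k / 2))) @[k --> +oo] --> 0.
  have -> : (fun k : R => (b + c * k) * expR (- (k / 2)) * expR (- (k / 2))) =
     (fun j : R => (b + c * (j * 2)) * expR (- j) * expR (- j)) \o (fun k => k / 2).
    by apply/funext => k /=; rewrite divfK// pnatr_eq0.
  apply: (@cvg_comp _ _ _ (fun k => k / 2)
    (fun j : R => (b + c * (j * 2)) * expR (- j) * expR (- j)) _ (+oo)).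
    by apply: gt0_cvgMly; [rewrite invr_gt0|exact: cvg_id].
  apply: (@cvg_expR_bounded (fun j : R => (b + c * (j * 2)) * expR (- j))
    (`|b| + `|c| * 2)) => k k0.
  rewrite mulrDl; apply: (le_trans (ler_normD _ _)); rewrite !normrM.
  have e1 : `|expR (- k)| <= 1.
    by rewrite ger0_norm ?expR_ge0// expRN invf_le1 ?expR_gt0// -expR0 ler_expR.
  have e2 : `|k| * `|expR (- k)| <= 1.
    rewrite !ger0_norm ?expR_ge0// expRN ler_pdivrMr ?expR_gt0// mul1r.
    by have := expR_ge1Dx k; lra.
  apply: lerD; first by rewrite -[leRHS]mulr1 ler_wpM2l.
  rewrite (@ger0_norm _ 2)//; have := normr_ge0 c; nra.
apply: cvg_trans h; apply: near_eq_cvg; apply: nearW => k.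
by rewrite -mulrA -expRD; congr (_ * expR _); lra.
Qed.

Lemma integral_linear_expR a x : x <= a ->
  (\int[mu]_(k in `[a, +oo[) ((k - x) * expR (- k))%:E
   = ((a - x + 1) * expR (- a))%:E)%E.
Proof.
move=> xa.
have dF k : is_derive k (1 : R) (fun k => ((x - 1) + (-1) * k) * expR (- k))
    ((k - x) * expR (- k)).
  apply: is_derive_eq.
  rewrite /GRing.scale/=; ring.
rewrite (integral_half_line _ _ dF).
- by congr EFin; ring.
- by move=> k ak; rewrite mulr_ge0 ?expR_ge0// subr_ge0 (le_trans xa).
- move=> k; apply: cvgM; first by apply: cvgB; [exact: cvg_id|exact: cvg_cst].
  by apply: continuous_comp; [exact: opp_continuous|exact: continuous_expR].
- exact: cvg_affine_expR.
Qed.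

(** This is the mean of [|x - k|] over an exponential [k]. The payoff at [- x] appears because the
    kink [k = x] is interior to the half line only for [x > 0]. *)
Lemma integral_dist_expR x :
  (\int[mu]_(k in `[0%R, +oo[) (`|x - k| * expR (- k))%:E
   = (`|x| + 1 - 2 * posp (1 - expR (- x)))%:E)%E.
Proof.
have [x0|x0] := leP x 0.
  transitivity (\int[mu]_(k in `[0%R, +oo[) ((k - x) * expR (- k))%:E)%E.
    apply: eq_integral => k; rewrite inE/= in_itv/= andbT => k0.
    by rewrite distrC ger0_norm// subr_ge0 (le_trans x0).
  rewrite integral_linear_expR// oppr0 expR0 ler0_norm//; congr EFin.
  rewrite /posp max_r ?mulr0; first by ring.
  by rewrite subr_le0 -expR0 ler_expR oppr_ge0.
rewrite (@itv_bndbnd_setU _ _ _ (BLeft x)) ?bnd_simp ?ltW//.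
have cf : continuous (fun k => `|x - k| * expR (- k)).
  move=> k; apply: cvgM.
    by apply: cvg_norm; apply: cvgB; [exact: cvg_cst|exact: cvg_id].
  by apply: continuous_comp; [exact: opp_continuous|exact: continuous_expR].
rewrite ge0_integral_setU//=; first last.
- apply/disj_setPRL => k /=; rewrite !in_itv/= andbT => xk.
  by rewrite ltNge xk/= andbF.
- apply/measurable_EFinP/measurable_funTS.
  exact: continuous_measurable_fun.
rewrite integral_itv_bndo_bndc; last first.
  apply/measurable_EFinP/measurable_funTS.
  exact: continuous_measurable_fun.
have -> : (\int[mu]_(k in `[0%R, x]) (`|x - k| * expR (- k))%:E
    = (expR (- x) - 1 + x)%:E)%E.
  rewrite (@continuous_FTC2 _ _ (fun k => (1 - x + k) * expR (- k)) 0 x x0).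
  - by rewrite -EFinB; congr EFin; rewrite oppr0 expR0; ring.
  - exact: continuous_subspaceT.
  - have dF k : is_derive k (1:R) (fun k => (1 - x + k) * expR (- k))
        ((x - k) * expR (- k)).
      apply: is_derive_eq.
      rewrite /GRing.scale/=; ring.
    have cF := is_derive_continuous dF.
    split => [k _||].
    + exact: (@ex_derive _ _ _ _ _ _ _ (dF k)).
    + exact/cvg_at_right_filter/cF.
    + exact/cvg_at_left_filter/cF.
  - move=> k; rewrite in_itv/= => /andP[_ kx].
    rewrite ger0_norm ?subr_ge0 ?ltW// derive1E.
    apply: derive_val; apply: is_derive_eq.
    rewrite /GRing.scale/=; ring.
have -> : (\int[mu]_(k in `[x, +oo[) (`|x - k| * expR (- k))%:E
    = (expR (- x))%:E)%E.
  transitivity (\int[mu]_(k in `[x, +oo[) ((k - x) * expR (- k))%:E)%E.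
    apply: eq_integral => k; rewrite inE/= in_itv/= andbT => k0.
    by rewrite distrC ger0_norm// subr_ge0.
  by rewrite integral_linear_expR// subrr add0r mul1r.
rewrite -EFinD gtr0_norm// /posp max_l; first by congr EFin; ring.
by rewrite subr_ge0 -expR0 ler_expR oppr_le0 ltW.
Qed.

(** The same mean on the Fourier side: [E e^{-iuk} = 1 / (1 + iu)], and the fraction is the real
    part of [e^{iux} / (1 + iu)]. *)
Lemma integral_cos_expR u x :
  (\int[mu]_(k in `[0%R, +oo[) ((1 - cos (u * (x - k))) * expR (- k))%:E
   = (1 - (cos (u * x) + u * sin (u * x)) / (1 + u ^+ 2))%:E)%E.
Proof.
have D0 : 1 + u ^+ 2 != 0 by rewrite gt_eqF// ltr_pwDl// sqr_ge0.
have dF k : is_derive k (1 : R) (fun k =>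
    ((cos (u * (x - k)) + u * sin (u * (x - k))) / (1 + u ^+ 2) - 1) * expR (- k))
    ((1 - cos (u * (x - k))) * expR (- k)).
  apply: is_derive_eq.
  by rewrite /GRing.scale/=; field; exact: D0.
rewrite (integral_half_line _ _ dF).
- by congr EFin; rewrite subr0 oppr0 expR0; ring.
- by move=> k _; rewrite mulr_ge0 ?expR_ge0// subr_cos_ge0.
- move=> k; apply: cvgM; last first.
    by apply: continuous_comp; [exact: opp_continuous|exact: continuous_expR].
  apply: cvgB; first exact: cvg_cst.
  apply: (@continuous_comp _ _ _ (fun k => u * (x - k)) cos).
    by apply: cvgM; [exact: cvg_cst|apply: cvgB; [exact: cvg_cst|exact: cvg_id]].
  exact: continuous_cos.
- apply: (@cvg_expR_bounded _ ((1 + `|u|) * `|(1 + u ^+ 2)^-1| + 1)) => k _.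
  apply: (le_trans (ler_normB _ _)); rewrite normr1 lerD2r normrM ler_wpM2r//.
  apply: (le_trans (ler_normD _ _)); rewrite lerD ?cos_max// normrM.
  by rewrite -[leRHS]mulr1 ler_wpM2l// sin_max.
Qed.

End laplace_integrals.

(** * Fourier representation of the put payoff *)

Section fourier_kernels.
Context {R : realType}.
Local Notation mu := (@lebesgue_measure R).
Implicit Types (x u k eta : R).

(** This constant is [pi]; it stays a common factor of all the kernel formulas until it is divided
    out. *)
Definition cos_const : R := \int[mu]_u ((1 - cos u) / u ^+ 2).

Lemma oneDsqr_pos u : 0 < 1 + u ^+ 2 :> R.
Proof. by rewrite ltr_pwDl// sqr_ge0. Qed.

(** In [t + t u^2], the first summand is at most [a u^2] and the second at most [b u^2]; at [u = 0]
    the quotient is 0 by convention. *)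
Lemma sqr_ratio_le (t a b u : R) : 0 <= a -> 0 <= b -> 0 <= t ->
  t <= a * u ^+ 2 -> t <= b -> t / u ^+ 2 <= (a + b) * (1 + u ^+ 2)^-1.
Proof.
move=> a0 b0 t0 ta tb; have [->|u0] := eqVneq u 0.
  by rewrite expr0n/= invr0 mulr0 mulr_ge0 ?addr_ge0// invr_ge0 ltW// oneDsqr_pos.
have u2 : 0 < u ^+ 2 by rewrite lt_neqAle sqr_ge0 andbT eq_sym sqrf_eq0.
rewrite ler_pdivrMr// mulrAC ler_pdivlMr ?oneDsqr_pos//; nra.
Qed.

Lemma subr_cos_ratio_le x u :
  `|(1 - cos (u * x)) / u ^+ 2| <= (x ^+ 2 + 2) * (1 + u ^+ 2)^-1.
Proof.
rewrite ger0_norm; last by rewrite divr_ge0 ?sqr_ge0 ?subr_cos_ge0.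
apply: sqr_ratio_le; rewrite ?sqr_ge0 ?subr_cos_ge0 ?subr_cos_le2//.
by rewrite -exprMn mulrC subr_cos_le_sqr.
Qed.

Lemma integrable_subr_cos x :
  mu.-integrable setT (EFin \o (fun u => (1 - cos (u * x)) / u ^+ 2)).
Proof.
apply: (le_oneDsqrV_integrable (k := x ^+ 2 + 2)); first by measurability.
exact: subr_cos_ratio_le.
Qed.

(** The substitution [u -> |x| u] in [cos_const], with the evenness of the cosine. *)
Lemma Rintegral_subr_cos x :
  \int[mu]_u ((1 - cos (u * x)) / u ^+ 2) = cos_const * `|x|.
Proof.
have [->|x0] := eqVneq x 0.
  rewrite normr0 mulr0 (@eq_Rintegral _ _ _ mu setT (fun=> 0)).
    by rewrite Rintegral_cst// mul0r.
  by move=> u _; rewrite mulr0 cos0 subrr mul0r.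
have k0 : 0 < `|x| by rewrite normr_gt0.
have int1 : mu.-integrable setT (EFin \o (fun u => (1 - cos u) / u ^+ 2)).
  have := integrable_subr_cos 1.
  by under eq_fun do rewrite /= mulr1.
rewrite /cos_const (Rintegral_scale k0 int1) mulrAC -expr2.
rewrite -RintegralZl//; last exact: (integrable_scale k0 int1).
apply: eq_Rintegral => u _.
have -> : cos (u * x) = cos (`|x| * u).
  by rewrite -cos_norm -[RHS]cos_norm !normrM normr_id mulrC.
by rewrite exprMn [in RHS]invfM [RHS]mulrCA mulVKf// expf_neq0// gt_eqF.
Qed.

Let half_line : set R := `[0, +oo[.

(** The joint integrand in [(u, k)] for Tonelli; the half line enters as an indicator so that both
    integrals run over the whole line. *)
Let weight (z : R * R) x : R :=
  (1 - cos (z.1 * (x - z.2))) / z.1 ^+ 2 * (expR (- z.2) * \1_half_line z.2).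

Let weight_ge0 z x : 0 <= weight z x.
Proof.
by rewrite /weight mulr_ge0 ?divr_ge0 ?sqr_ge0 ?subr_cos_ge0.
Qed.

Let measurable_weight x : measurable_fun setT (fun z : measurableTypeR R * measurableTypeR R => (weight z x)%:E).
Proof.
apply/measurable_EFinP; rewrite /weight; measurability.
apply: (measurableT_comp (f := \1_half_line : R -> R)).
  by apply: measurable_indic; exact: measurable_itv.
exact: measurable_snd.
Qed.

Let integral_half_lineE (f : R -> R) :
  (\int[mu]_k (f k * \1_half_line k)%:E = \int[mu]_(k in half_line) (f k)%:E)%E.
Proof.
rewrite [RHS]integral_mkcond; apply: eq_integral => k _.
rewrite patchE indicE; case: ifPn => _; first by rewrite mulr1.
by rewrite mulr0.
Qed.

(* Averaging [|x - k|] over an exponential time [k] produces the put payoff. *)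
Lemma integral_averaged_kernel x :
  (\int[mu]_u ((1 - (cos (u * x) + u * sin (u * x)) / (1 + u ^+ 2)) / u ^+ 2)%:E
   = (cos_const * (`|x| + 1 - 2 * posp (1 - expR (- x))))%:E)%E.
Proof.
have := @fubini_tonelli _ _ _ _ R mu mu (fun z => (weight z x)%:E)
  (measurable_weight x) (fun z => weight_ge0 z x).
have -> : (\int[mu]_u \int[mu]_k (weight (u, k) x)%:E)%E =
    (\int[mu]_u ((1 - (cos (u * x) + u * sin (u * x)) / (1 + u ^+ 2)) / u ^+ 2)%:E)%E.
  apply: eq_integral => u _.
  transitivity (\int[mu]_k (((u ^+ 2)^-1)%:E *
      ((1 - cos (u * (x - k))) * expR (- k) * \1_half_line k)%:E))%E.
    by apply: eq_integral => k _; rewrite -EFinM /weight/=; congr EFin; ring.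
  rewrite ge0_integralZl//.
  - rewrite integral_half_lineE integral_cos_expR -EFinM; congr EFin; ring.
  - apply/measurable_EFinP; measurability.
    by apply: measurable_indic; exact: measurable_itv.
  - by rewrite lee_fin invr_ge0 sqr_ge0.
move=> ->.
transitivity (\int[mu]_k (cos_const%:E *
    (`|x - k| * expR (- k) * \1_half_line k)%:E))%E.
  apply: eq_integral => k _; rewrite -EFinM.
  transitivity (\int[mu]_u ((expR (- k) * \1_half_line k)%:E *
    ((1 - cos (u * (x - k))) / u ^+ 2)%:E))%E.
    by apply: eq_integral => u _; rewrite -EFinM /weight/=; congr EFin; ring.
  rewrite ge0_integralZl//.
  - rewrite (integral_RintegralE (integrable_subr_cos (x - k))).
    rewrite Rintegral_subr_cos -EFinM; congr EFin; ring.
  - by apply/measurable_EFinP; measurability.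
  - by move=> u _; rewrite lee_fin divr_ge0 ?sqr_ge0 ?subr_cos_ge0.
rewrite ge0_integralZl//.
- by rewrite integral_half_lineE integral_dist_expR -EFinM.
- apply/measurable_EFinP; measurability.
  by apply: measurable_indic; exact: measurable_itv.
- rewrite lee_fin; apply: Rintegral_ge0 => u _.
  by rewrite divr_ge0 ?sqr_ge0 ?subr_cos_ge0.
Qed.

(** The kernel is nonnegative as a mean of [1 - cos], so the finite value of its integral gives
    integrability. *)
Lemma integrable_averaged_kernel x : mu.-integrable setT (EFin \o
  (fun u => (1 - (cos (u * x) + u * sin (u * x)) / (1 + u ^+ 2)) / u ^+ 2)).
Proof.
apply: ge0_integrableR; first by measurability.
  move=> u; rewrite mulr_ge0 ?invr_ge0 ?sqr_ge0// -lee_fin -integral_cos_expR.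
  by apply: integral_ge0 => k _; rewrite lee_fin mulr_ge0 ?expR_ge0 ?subr_cos_ge0.
by rewrite /= integral_averaged_kernel ltry.
Qed.

Definition put_payoff x : R := posp (1 - expR x).

(** The kernel of [|x|] minus the averaged kernel at [x] has integral [cos_const] times
    [2 p(-x) - 1]; adding the averaged kernel at 0, of integral [cos_const], removes the [- 1]. *)
Lemma put_kernel x : let f u :=
    (1 - cos (u * x)) * (1 + u ^+ 2)^-1 + sin (u * x) / u * (1 + u ^+ 2)^-1 in
  mu.-integrable setT (EFin \o f) /\
  \int[mu]_u f u = 2 * cos_const * put_payoff (- x).
Proof.
move=> f.
pose g u := (1 - cos (u * x)) / u ^+ 2.
pose h y u := (1 - (cos (u * y) + u * sin (u * y)) / (1 + u ^+ 2)) / u ^+ 2.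
have fE : f = (fun u => (g u - h x u) + h 0 u).
  apply/funext => u; rewrite /f /g /h mulr0 cos0 sin0 mulr0.
  have [->|u0] := eqVneq u 0.
    by rewrite !mul0r cos0 sin0 expr0n/= invr0 !mulr0; ring.
  by field; rewrite u0 gt_eqF// oneDsqr_pos.
have ig := integrable_subr_cos x.
have ihx := integrable_averaged_kernel x.
have ih0 := integrable_averaged_kernel 0.
have igh : mu.-integrable setT (EFin \o (fun u => g u - h x u)).
  exact: integrableBR.
rewrite fE; split; first exact: integrableDR.
rewrite RintegralD// RintegralB// Rintegral_subr_cos.
rewrite /Rintegral !integral_averaged_kernel/= normr0 oppr0 expR0 subrr.
rewrite /put_payoff /posp maxxx; ring.
Qed.

End fourier_kernels.

(** The sequential form of a derivative at 0, which supplies the pointwise limits for dominated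
    convergence along small times. *)
Lemma is_derive0_cvg {R : realType} (F : R -> R) (l : R) (t : nat -> R) :
  is_derive (0 : R) (1 : R) F l -> F 0 = 0 -> (forall n, t n != 0) ->
  t n @[n --> \oo] --> 0 -> F (t n) / t n @[n --> \oo] --> l.
Proof.
move=> dF F0 t0 tcvg.
have [+ dval] := dF; rewrite /derivable => dF'.
have : (fun h : R => h^-1 *: ((F \o shift 0) (h *: 1) - F 0)) @ 0^' --> l.
  by rewrite -dval.
move=> H.
have tcvg' : t n @[n --> \oo] --> 0^'.
  move=> A /= [e /= e0 Ae].
  have /cvgrPdist_lt/(_ e e0) : t n @[n --> \oo] --> 0 by [].
  by apply: filterS => n tn; apply: Ae => //=.
apply: cvg_trans (cvg_comp _ _ tcvg' H); apply: near_eq_cvg; apply: nearW => n /=.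
by rewrite F0 subr0 addr0 /GRing.scale/= mulr1 mulrC.
Qed.

(** * Even and odd parts of the put payoff *)

Section put_payoff.
Context {R : realType}.
Implicit Types (x u eta : R).

(** Explicitly [1 - e^{-|x|}], with a kink at 0, whereas [odd_payoff] is this times the sign of [x],
    which is [C^1] with slope 1 at 0. *)
Definition even_payoff x : R := put_payoff x + put_payoff (- x).
Definition odd_payoff x : R := put_payoff (- x) - put_payoff x.

Lemma put_payoff_ge0 x : 0 <= put_payoff x.
Proof. by rewrite /put_payoff /posp le_max lexx orbT. Qed.

Lemma put_payoff_pos x : 0 <= x -> put_payoff x = 0.
Proof.
by move=> x0; rewrite /put_payoff /posp max_r// subr_le0 -expR0 ler_expR.
Qed.

Lemma put_payoff_neg x : x <= 0 -> put_payoff x = 1 - expR x.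
Proof.
by move=> x0; rewrite /put_payoff /posp max_l// subr_ge0 -expR0 ler_expR.
Qed.

Lemma put_payoff_le1 x : put_payoff x <= 1.
Proof.
have [x0|/ltW x0] := leP 0 x; first by rewrite put_payoff_pos.
by rewrite put_payoff_neg// lerBlDr lerDl expR_ge0.
Qed.

Lemma put_payoff_le_norm x : put_payoff x <= `|x|.
Proof.
have [x0|/ltW x0] := leP 0 x; first by rewrite put_payoff_pos.
by rewrite put_payoff_neg// ler0_norm//; have := expR_ge1Dx x; lra.
Qed.

Lemma even_payoff_ge0 x : 0 <= even_payoff x.
Proof. by rewrite addr_ge0// put_payoff_ge0. Qed.

(** The bound is the function that a Levy measure of finite variation integrates. *)
Lemma even_payoff_le x : even_payoff x <= Num.min `|x| 1.
Proof.
rewrite /even_payoff; have [x0|/ltW x0] := leP 0 x.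
  rewrite put_payoff_pos// add0r le_min -normrN.
  by rewrite put_payoff_le_norm put_payoff_le1.
rewrite (@put_payoff_pos (- x)) ?oppr_ge0// addr0 le_min.
by rewrite put_payoff_le_norm put_payoff_le1.
Qed.

Lemma odd_payoff_le x : `|odd_payoff x| <= even_payoff x.
Proof.
rewrite /odd_payoff /even_payoff ler_norml.
by have := put_payoff_ge0 x; have := put_payoff_ge0 (- x); lra.
Qed.

Lemma put_payoffE x : 2 * put_payoff x = even_payoff x - odd_payoff x.
Proof. by rewrite /even_payoff /odd_payoff; ring. Qed.

End put_payoff.

(** * Fourier kernels of the even and odd payoffs *)

Section derived_kernels.
Context {R : realType}.
Local Notation mu := (@lebesgue_measure R).
Local Notation c := (@cos_const R).
Implicit Types (x u eta : R).

(** Averaging [put_kernel] over [x] and [- x] cancels the sine term. *)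
Lemma cos_kernel x : let f u := (1 - cos (u * x)) * (1 + u ^+ 2)^-1 in
  mu.-integrable setT (EFin \o f) /\ \int[mu]_u f u = c * even_payoff x.
Proof.
move=> f; have [i1 e1] := put_kernel x; have [i2 e2] := put_kernel (- x).
have fE : f = (fun u => 2^-1 *
  (((1 - cos (u * x)) * (1 + u ^+ 2)^-1 + sin (u * x) / u * (1 + u ^+ 2)^-1) +
   ((1 - cos (u * - x)) * (1 + u ^+ 2)^-1 + sin (u * - x) / u * (1 + u ^+ 2)^-1))).
  apply/funext => u; rewrite /f mulrN cosN sinN !mulNr.
  by set y := _ / u; set w := (1 + _)^-1; field.
rewrite fE; split; first exact/integrableZlR/integrableDR.
rewrite RintegralZl//; last exact: integrableDR.
by rewrite RintegralD// e1 e2 opprK /even_payoff; field.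
Qed.

(** Half the difference of [put_kernel] at [x] and [- x] cancels the cosine term. *)
Lemma sin_kernel x : let f u := sin (u * x) / u * (1 + u ^+ 2)^-1 in
  mu.-integrable setT (EFin \o f) /\ \int[mu]_u f u = c * odd_payoff x.
Proof.
move=> f; have [i1 e1] := put_kernel x; have [i2 e2] := put_kernel (- x).
have fE : f = (fun u => 2^-1 *
  (((1 - cos (u * x)) * (1 + u ^+ 2)^-1 + sin (u * x) / u * (1 + u ^+ 2)^-1) -
   ((1 - cos (u * - x)) * (1 + u ^+ 2)^-1 + sin (u * - x) / u * (1 + u ^+ 2)^-1))).
  apply/funext => u; rewrite /f mulrN cosN sinN !mulNr.
  by set y := _ / u; set w := (1 + _)^-1; field.
rewrite fE; split; first exact/integrableZlR/integrableBR.
rewrite RintegralZl//; last exact: integrableBR.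
by rewrite RintegralB// e1 e2 opprK /odd_payoff; field.
Qed.

(** For [u] nonzero this is [1 / (u (1 + u^2))] minus [eta^2 / (u (eta^2 + u^2))], the weights
    representing [odd_payoff x] and [odd_payoff (eta * x)]; their poles at 0 cancel. *)
Definition odd_weight eta u : R :=
  (1 - eta ^+ 2) * u / ((1 + u ^+ 2) * (eta ^+ 2 + u ^+ 2)).

Lemma measurable_odd_weight eta : measurable_fun setT (odd_weight eta).
Proof. by rewrite /odd_weight; measurability. Qed.

(* The gain of one order of decay over [sin_kernel], near [0] and at infinity,
   makes the weight integrable against the linearly growing exponent. *)
Lemma odd_weight_le eta u : 0 < eta < 1 ->
  (1 + `|u|) * `|odd_weight eta u| <= (eta ^- 2 + 2) * (1 + u ^+ 2)^-1.
Proof.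
move=> /andP[e0 e1].
have e2 : 0 < eta ^+ 2 by rewrite exprn_gt0.
have e21 : eta ^+ 2 <= 1 by rewrite expr_le1 ?ltW.
have d1 : 0 < eta ^+ 2 + u ^+ 2 by rewrite ltr_pwDl// sqr_ge0.
have key : (1 + `|u|) * `|u| * (eta ^+ 2 + u ^+ 2)^-1 <= eta ^- 2 + 2.
  rewrite ler_pdivrMr//.
  have -> : (1 + `|u|) * `|u| = `|u| + u ^+ 2.
    by rewrite mulrDl mul1r -expr2 real_normK ?num_real.
  have -> : (eta ^- 2 + 2) * (eta ^+ 2 + u ^+ 2) =
      1 + eta ^- 2 * u ^+ 2 + 2 * eta ^+ 2 + 2 * u ^+ 2.
    by field; rewrite gt_eqF.
  have h1 : 0 <= eta ^- 2 * u ^+ 2 by rewrite mulr_ge0 ?sqr_ge0// invr_ge0 ltW.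
  have h2 := sqr_ge0 (`|u| - 1); have h3 := sqr_ge0 u.
  by move: h2; rewrite sqrrB1 real_normK ?num_real//; lra.
rewrite /odd_weight invfM !normrM !normfV.
rewrite (gtr0_norm d1) (gtr0_norm (oneDsqr_pos u)).
have -> : `|1 - eta ^+ 2| = 1 - eta ^+ 2 by rewrite ger0_norm// subr_ge0.
have w0 : 0 <= (1 + u ^+ 2)^-1 by rewrite invr_ge0 ltW// oneDsqr_pos.
have k0 : 0 <= (1 + `|u|) * `|u| * (eta ^+ 2 + u ^+ 2)^-1.
  by rewrite !mulr_ge0 ?addr_ge0// invr_ge0 ltW.
have -> : (1 + `|u|) * ((1 - eta ^+ 2) * `|u| * ((1 + u ^+ 2)^-1 * (eta ^+ 2 + u ^+ 2)^-1))
  = (1 - eta ^+ 2) * ((1 + `|u|) * `|u| * (eta ^+ 2 + u ^+ 2)^-1) * (1 + u ^+ 2)^-1.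
  by ring.
rewrite ler_wpM2r// (le_trans _ key)//.
by rewrite -[leRHS]mul1r ler_wpM2r// lerBlDr lerDl ltW.
Qed.

Lemma integrable_odd_weight eta (g : R -> R) (M : R) : 0 < eta < 1 ->
  measurable_fun setT g -> (forall u, `|g u| <= M * (1 + `|u|)) ->
  mu.-integrable setT (EFin \o (fun u => g u * odd_weight eta u)).
Proof.
move=> eta01 mg gM.
have M0 : 0 <= M.
  by have := le_trans (normr_ge0 _) (gM 0); rewrite normr0 addr0 mulr1.
apply: (le_oneDsqrV_integrable (k := M * (eta ^- 2 + 2))).
  by measurability; exact: measurable_odd_weight.
move=> u; rewrite normrM -mulrA.
apply: le_trans (ler_wpM2l M0 (odd_weight_le u eta01)).
by rewrite mulrA ler_wpM2r.
Qed.

(** Substituting [u / eta] in the kernel of [odd_payoff (eta * x)] brings both terms to the same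
    [sin (u * x)]. *)
Lemma odd_kernel eta x : 0 < eta < 1 ->
  \int[mu]_u (sin (u * x) * odd_weight eta u) =
  c * (odd_payoff x - odd_payoff (eta * x)).
Proof.
move=> /andP[e0 e1]; rewrite mulrBr.
have [i1 <-] := sin_kernel x; have [i2 <-] := sin_kernel (eta * x).
have V0 : 0 < eta^-1 by rewrite invr_gt0.
rewrite [in X in _ - X](Rintegral_scale V0 i2).
have i2' := integrable_scale V0 i2.
rewrite -RintegralZl// -RintegralB//; last exact: (integrableZlR _ i2').
apply: eq_Rintegral => u _; rewrite /odd_weight.
have -> : eta^-1 * u * (eta * x) = u * x by field; rewrite gt_eqF.
have [->|u0] := eqVneq u 0; first by rewrite !mul0r sin0; ring.
field; rewrite u0 (gt_eqF e0) (gt_eqF (oneDsqr_pos u)).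
by rewrite gt_eqF// ltr_pwDl ?sqr_ge0// exprn_gt0.
Qed.

(** This is [odd_kernel] differentiated at [x = 0]: its difference quotients along [x = 1 / (n + 1)]
    converge on both sides, under the integral by domination. *)
Lemma Rintegral_odd_weight eta : 0 < eta < 1 ->
  \int[mu]_u (u * odd_weight eta u) = c * (1 - eta).
Proof.
move=> /[dup] eta01 /andP[e0 e1].
pose t n : R := n.+1%:R^-1.
have t0 n : 0 < t n by rewrite invr_gt0.
have tcvg : t n @[n --> \oo] --> 0 by exact: cvg_harmonic.
have H1 : \int[mu]_u (sin (u * t n) / t n * odd_weight eta u) @[n --> \oo] -->
    \int[mu]_u (u * odd_weight eta u).
  apply: (@dominated_cvgR _ _ _ mu (fun n u => sin (u * t n) / t n * odd_weight eta u)
    _ (fun u => `|u| * `|odd_weight eta u|)).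
  - by move=> n; measurability; exact: measurable_odd_weight.
  - move=> u; apply: cvgM; last exact: cvg_cst.
    apply: (@is_derive0_cvg R (fun y => sin (u * y)) u t) => //.
    + apply: is_derive_eq; rewrite mulr0 cos0 /GRing.scale/=; ring.
    + by rewrite mulr0 sin0.
    + by move=> n; rewrite gt_eqF.
  - apply: (le_oneDsqrV_integrable (k := eta ^- 2 + 2)).
      by measurability; exact: measurable_odd_weight.
    move=> u; rewrite normrM !normr_id (le_trans _ (odd_weight_le u eta01))//.
    by rewrite ler_wpM2r// lerDr.
  - move=> n u; rewrite normrM ler_wpM2r// normrM normfV (gtr0_norm (t0 n)).
    by rewrite ler_pdivrMr// (le_trans (sin_le_normr _))// normrM (gtr0_norm (t0 n)).
have H2 : \int[mu]_u (sin (u * t n) / t n * odd_weight eta u) @[n --> \oo] -->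
    c * (1 - eta).
  have -> : (fun n => \int[mu]_u (sin (u * t n) / t n * odd_weight eta u)) =
      (fun n => c * ((expR (- (eta * t n)) - expR (- t n)) / t n)).
    apply/funext => n.
    have tn1 : - t n <= 0 by rewrite oppr_le0 ltW.
    have tn2 : - (eta * t n) <= 0 by rewrite oppr_le0 ltW// mulr_gt0.
    transitivity ((t n)^-1 * \int[mu]_u (sin (u * t n) * odd_weight eta u)).
      rewrite -RintegralZl//; last first.
        apply: (@integrable_odd_weight eta (fun u => sin (u * t n)) 1) => //.
          by measurability.
        by move=> u; rewrite mul1r (le_trans (sin_max _))// lerDl.
      by apply: eq_Rintegral => u _; ring.
    rewrite odd_kernel// /odd_payoff (put_payoff_neg tn1) (put_payoff_neg tn2).
    rewrite !put_payoff_pos ?(ltW (t0 n)) ?(ltW (mulr_gt0 e0 (t0 n)))//; ring.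
  apply: cvgM; first exact: cvg_cst.
  apply: (@is_derive0_cvg R (fun y => expR (- (eta * y)) - expR (- y)) (1 - eta) t) => //.
  + by apply: is_derive_eq; rewrite mulr0 oppr0 expR0 /GRing.scale/=; ring.
  + by rewrite mulr0 oppr0 expR0 subrr.
  + by move=> n; rewrite gt_eqF.
exact: (cvg_unique (@Rhausdorff R) H1 H2).
Qed.

(** On [[pi/2, pi]] the cosine is nonpositive, so the integrand is at least [1 / pi^2] there. *)
Lemma cos_const_gt0 : 0 < c.
Proof.
have int1 : mu.-integrable setT (EFin \o (fun u => (1 - cos u) / u ^+ 2)).
  by have := @integrable_subr_cos R 1; under eq_fun do rewrite /= mulr1.
rewrite -lte_fin /cos_const -(integral_RintegralE int1).
have f0 u : 0 <= (1 - cos u) / u ^+ 2 by rewrite divr_ge0 ?sqr_ge0 ?subr_cos_ge0.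
have mf : measurable_fun setT (fun u : R => (1 - cos u) / u ^+ 2) by measurability.
pose D : set R := `[(pi / 2), pi]%classic.
apply: (@lt_le_trans _ _ (\int[mu]_(u in D) (pi ^- 2)%:E)%E).
  rewrite integral_cst; last exact: measurable_itv.
  have p2 : (pi / 2 : R) < pi by rewrite ltr_pdivrMr// ltr_pMr ?pi_gt0// ltr1n.
  rewrite [X in (_ < _ * X)%E](_ : _ = (pi - pi / 2)%:E).
    by rewrite -EFinM lte_fin mulr_gt0 ?subr_gt0// invr_gt0 exprn_gt0// pi_gt0.
  have : (@lebesgue_measure R D = (pi - pi / 2)%:E).
    by rewrite lebesgue_measure_itv/= lte_fin p2 EFinB.
  by [].
apply: (@le_trans _ _ (\int[mu]_(u in D) ((1 - cos u) / u ^+ 2)%:E)%E).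
  apply: ge0_le_integral => //=.
  - exact: measurable_itv.
  - by move=> u _; rewrite lee_fin invr_ge0 exprn_ge0// pi_ge0.
  - exact/measurable_EFinP/measurable_funTS.
  - move=> u; rewrite /D/= in_itv/= => /andP[u1 u2]; rewrite lee_fin.
    have u0 : 0 < u by rewrite (lt_le_trans _ u1)// divr_gt0// pi_gt0.
    rewrite -[leLHS]mul1r; apply: ler_pM => //.
    - by rewrite invr_ge0 exprn_ge0// pi_ge0.
    - rewrite lerBrDr gerDl -(subrK (pi / 2) u) cosDpihalf oppr_le0.
      apply: sin_ge0_pi; rewrite subr_ge0 u1/= (le_trans _ u2)// gerBl.
      by rewrite divr_ge0// pi_ge0.
    - by rewrite lef_pV2 ?posrE ?exprn_gt0 ?pi_gt0// lerXn2r// nnegrE ltW// pi_gt0.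
apply: ge0_subset_integral => //; first exact: measurable_itv.
- exact/measurable_EFinP.
- by move=> u _; rewrite lee_fin.
Qed.

End derived_kernels.

(** * Fourier exponents of a measure *)

Section exponents.
Context {R : realType} {d : measure_display} {T : measurableType d}.
Variable m : {sigma_finite_measure set T -> \bar R}.
Variable Y : T -> R.
Local Notation mu := (@lebesgue_measure R).
Hypothesis mY : measurable_fun setT Y.
Local Notation kappa := (fun t => Num.min `|Y t| 1).
Hypothesis intY : m.-integrable setT (EFin \o kappa).
Implicit Types (u v eta : R).

(** Minus the real part of the integral of [e^{iuY} - 1], whose imaginary part is [sin_exponent]. A
    general pair [(m, Y)] covers both the Levy measure with the identity and [P] with a random
    variable. *)
Definition cos_exponent u := \int[m]_t (1 - cos (u * Y t)).
Definition sin_exponent u := \int[m]_t sin (u * Y t).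

Let M : R := \int[m]_t kappa t.

Let kappa_ge0 t : 0 <= kappa t.
Proof. by rewrite le_min normr_ge0/=. Qed.

Let mkappa : measurable_fun setT kappa.
Proof. by measurability. Qed.

Lemma subr_cos_exponent_le u (y : R) :
  1 - cos (u * y) <= 2 * (1 + `|u|) * Num.min `|y| 1.
Proof.
have u0 := normr_ge0 u; have y0 := normr_ge0 y.
case: (leP `|y| 1) => _.
  by rewrite (le_trans (subr_cos_le_norm _))// normrM; nra.
by rewrite (le_trans (subr_cos_le2 _))//; lra.
Qed.

Lemma sin_exponent_le u (y : R) :
  `|sin (u * y)| <= (1 + `|u|) * Num.min `|y| 1.
Proof.
have u0 := normr_ge0 u; have y0 := normr_ge0 y.
case: (leP `|y| 1) => _.
  by rewrite (le_trans (sin_le_normr _))// normrM; nra.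
by rewrite (le_trans (sin_max _))//; lra.
Qed.

Lemma integrable_cos_exponent u :
  m.-integrable setT (EFin \o (fun t => 1 - cos (u * Y t))).
Proof.
apply: le_integrableR (integrableZlR (2 * (1 + `|u|)) intY).
  by measurability.
by move=> t; rewrite ger0_norm ?subr_cos_ge0 ?subr_cos_exponent_le.
Qed.

Lemma integrable_sin_exponent u :
  m.-integrable setT (EFin \o (fun t => sin (u * Y t))).
Proof.
apply: le_integrableR (integrableZlR (1 + `|u|) intY).
  by measurability.
by move=> t; exact: sin_exponent_le.
Qed.

Lemma cos_exponent_ge0 u : 0 <= cos_exponent u.
Proof. by apply: Rintegral_ge0 => t _; exact: subr_cos_ge0. Qed.

Lemma sin_exponent_bound u : `|sin_exponent u| <= M * (1 + `|u|).
Proof.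
rewrite mulrC /M -RintegralZl//.
apply: le_trans (le_normr_Rintegral measurableT (integrable_sin_exponent u)) _.
apply: le_Rintegral => //.
- exact/integrable_norm/integrable_sin_exponent.
- exact: integrableZlR.
- by move=> t _; exact: sin_exponent_le.
Qed.

Let measurable_Rintegral (f : R * T -> R) : measurable_fun setT f ->
  (forall z, 0 <= f z) -> measurable_fun setT (fun u => \int[m]_t f (u, t)).
Proof.
move=> mf f0.
apply: (measurableT_comp (f := fine)); first exact: fine_measurable.
apply: (measurable_fun_fubini_tonelli_F (m2 := m) (EFin \o f)).
  exact/measurable_EFinP.
by move=> z; rewrite lee_fin.
Qed.

Lemma measurable_cos_exponent : measurable_fun setT cos_exponent.
Proof.
apply: (measurable_Rintegral (f := fun z => 1 - cos (z.1 * Y z.2))).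
  by measurability; exact: (measurableT_comp mY).
by move=> z; exact: subr_cos_ge0.
Qed.

(** The sine changes sign, so its majorant is added to reach the nonnegative case, and the explicit
    integral of the majorant is then subtracted. *)
Lemma measurable_sin_exponent : measurable_fun setT sin_exponent.
Proof.
pose f (z : R * T) := sin (z.1 * Y z.2) + (1 + `|z.1|) * kappa z.2.
have mY2 : measurable_fun setT (fun z : R * T => Y z.2).
  exact: (measurableT_comp mY).
have mf : measurable_fun setT f by measurability.
have f0 z : 0 <= f z.
  by have := sin_exponent_le z.1 (Y z.2); rewrite ler_norml /f; lra.
have -> : sin_exponent = (fun u => \int[m]_t f (u, t) - (1 + `|u|) * M).
  apply/funext => u; rewrite /f RintegralD//.
  - by rewrite /= RintegralZl// addrK.
  - exact: integrable_sin_exponent.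
  - exact: (integrableZlR (1 + `|u|) intY).
apply: measurable_addr; first exact: measurable_Rintegral.
by measurability.
Qed.

Lemma integrable_even_payoff eta : 0 < eta <= 1 ->
  m.-integrable setT (EFin \o (fun t => even_payoff (eta * Y t))).
Proof.
move=> /andP[e0 e1]; apply: le_integrableR intY.
  by rewrite /even_payoff /put_payoff /posp; measurability.
move=> t; rewrite ger0_norm ?even_payoff_ge0// (le_trans (even_payoff_le _))//.
rewrite normrM (gtr0_norm e0) le_min ge_min ge_min lexx orbT andbT.
by rewrite ler_piMl.
Qed.

Lemma integrable_odd_payoff eta : 0 < eta <= 1 ->
  m.-integrable setT (EFin \o (fun t => odd_payoff (eta * Y t))).
Proof.
move=> eta01; apply: le_integrableR (integrable_even_payoff eta01).
  by rewrite /odd_payoff /put_payoff /posp; measurability.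
by move=> t; exact: odd_payoff_le.
Qed.

(** Tonelli exchanges the integrals in [u] and [t], and [cos_kernel] evaluates the inner one; the
    finite value then gives integrability. *)
Lemma cos_exponent_kernel eta : 0 < eta <= 1 ->
  let f u := cos_exponent (eta * u) * (1 + u ^+ 2)^-1 in
  mu.-integrable setT (EFin \o f) /\
  \int[mu]_u f u = @cos_const R * \int[m]_t even_payoff (eta * Y t).
Proof.
move=> eta01 f.
have w0 u : 0 <= (1 + u ^+ 2)^-1 :> R by rewrite invr_ge0 ltW// oneDsqr_pos.
have f0 u : 0 <= f u by rewrite mulr_ge0// cos_exponent_ge0.
have mf : measurable_fun setT f.
  rewrite /f; measurability.
  apply: (measurableT_comp measurable_cos_exponent).
  exact: (@mulrl_measurable R setT eta).
have ie := integrable_even_payoff eta01.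
pose F (z : measurableTypeR R * T) : \bar R :=
  ((1 - cos (z.1 * (eta * Y z.2))) * (1 + z.1 ^+ 2)^-1)%:E.
have mF : measurable_fun setT F.
  by apply/measurable_EFinP; measurability; exact: (measurableT_comp mY).
have F0 z : (0 <= F z)%E by rewrite lee_fin mulr_ge0// subr_cos_ge0.
have fub := @fubini_tonelli _ _ _ _ R mu m F mF F0.
have fE : (\int[mu]_u (f u)%:E = (@cos_const R * \int[m]_t even_payoff (eta * Y t))%:E)%E.
  transitivity (\int[mu]_u \int[m]_t F (u, t))%E.
    apply: eq_integral => u _; rewrite /f /F.
    rewrite mulrC EFinM -(integral_RintegralE (integrable_cos_exponent _)).
    rewrite -ge0_integralZl//; first last.
    - by rewrite lee_fin.
    - exact: (measurable_int m (integrable_cos_exponent _)).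
    by apply: eq_integral => t _; rewrite -EFinM mulrC/= mulrA (mulrC u).
  rewrite fub EFinM -(integral_RintegralE ie) -ge0_integralZl//; first last.
  - by rewrite lee_fin ltW// cos_const_gt0.
  - by move=> t _; rewrite lee_fin even_payoff_ge0.
  - exact: (measurable_int m ie).
  apply: eq_integral => t _; rewrite -EFinM /F/=.
  by have [i <-] := cos_kernel (eta * Y t); rewrite integral_RintegralE.
have intf : mu.-integrable setT (EFin \o f).
  by apply: ge0_integrableR => //; rewrite fE ltry.
by split => //; apply: EFin_inj; rewrite -integral_RintegralE.
Qed.

(** Fubini and [odd_kernel]. Absolute integrability holds because the sine is at most
    [(1 + |u|) min(|Y|, 1)] and [odd_weight] absorbs the linear factor. *)
Lemma sin_exponent_kernel eta : 0 < eta < 1 ->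
  \int[mu]_u (sin_exponent u * odd_weight eta u) =
  @cos_const R * (\int[m]_t odd_payoff (Y t) - \int[m]_t odd_payoff (eta * Y t)).
Proof.
move=> /[dup] eta01 /andP[e0 e1].
pose F (z : measurableTypeR R * T) : \bar R :=
  (sin (z.1 * Y z.2) * odd_weight eta z.1)%:E.
have mb : measurable_fun setT (odd_weight eta) := measurable_odd_weight eta.
have mb1 : measurable_fun setT (fun z : measurableTypeR R * T => odd_weight eta z.1).
  exact: (measurableT_comp mb).
have mY2 : measurable_fun setT (fun z : measurableTypeR R * T => Y z.2).
  exact: (measurableT_comp mY).
have mF : measurable_fun setT F by apply/measurable_EFinP; measurability.
have ib : mu.-integrable setT (EFin \o (fun u => (1 + `|u|) * odd_weight eta u)).
  apply: (@integrable_odd_weight _ _ _ 1) => //; first by measurability.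
  by move=> u; rewrite mul1r ger0_norm// addr_ge0.
have intF : (mu \x m)%E.-integrable setT F.
  apply/integrable12ltyP => //.
  apply: (@le_lt_trans _ _ (\int[mu]_u (M * `|(1 + `|u|) * odd_weight eta u|)%:E)%E).
    apply: ge0_le_integral => //.
    - by move=> u _; exact: integral_ge0.
    - apply: (measurable_fun_fubini_tonelli_F (m2 := m) (abse \o F)) => //.
        exact: measurableT_comp.
      by move=> z; exact: abse_ge0.
    - by apply/measurable_EFinP; measurability.
    - move=> u _.
      have -> : (M * `|(1 + `|u|) * odd_weight eta u|)%:E =
        (\int[m]_t (`|(1 + `|u|) * odd_weight eta u| * kappa t)%:E)%E.
        by rewrite integral_RintegralE ?RintegralZl 1?mulrC//; exact: integrableZlR.
      apply: ge0_le_integral => //.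
      + by apply/measurable_EFinP; measurability.
      + by apply/measurable_EFinP; measurability.
      + move=> t _; rewrite /F/= lee_fin; set b := odd_weight eta u.
        rewrite !normrM [leRHS]mulrAC ler_wpM2r//.
        by rewrite (@ger0_norm _ (1 + _)) ?addr_ge0// sin_exponent_le.
  have iN := integrableZlR M (integrable_norm ib).
  by rewrite integral_RintegralE// ltry.
have fub := Fubini intF.
have i1 := @integrable_odd_payoff 1; rewrite ltr01 lexx in i1; have {}i1 := i1 isT.
have {}i1 : m.-integrable setT (EFin \o (fun t => odd_payoff (Y t))).
  by move: i1; under eq_fun do rewrite /= mul1r.
have i2 : m.-integrable setT (EFin \o (fun t => odd_payoff (eta * Y t))).
  by apply: integrable_odd_payoff; rewrite e0 ltW.
rewrite -RintegralB// -RintegralZl//; last exact: integrableBR.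
rewrite /Rintegral; congr fine.
transitivity (\int[mu]_u \int[m]_t F (u, t))%E.
  apply: eq_integral => u _; rewrite /F/= mulrC.
  rewrite -RintegralZl//; last exact: integrable_sin_exponent.
  rewrite -integral_RintegralE; last exact/integrableZlR/integrable_sin_exponent.
  by apply: eq_integral => t _; rewrite mulrC.
rewrite fub; apply: eq_integral => t _; rewrite -odd_kernel//.
rewrite -integral_RintegralE//.
apply: (@integrable_odd_weight _ _ _ 1) => //; first by measurability.
by move=> u; rewrite mul1r (le_trans (sin_max _))// lerDl.
Qed.

(** On the frequency scale [1 / th n] the jumps vanish beside the drift: the integrand is at most
    [th n], and [th n <= 1] makes [(1 + |v|) min(|Y|, 1)] a uniform majorant. *)
Lemma sin_exponent_scale_cvg (th : nat -> R) v :
  (forall n, 0 < th n <= 1) -> th n @[n --> \oo] --> 0 ->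
  th n * sin_exponent (v / th n) @[n --> \oo] --> 0.
Proof.
move=> th01 th0.
have -> : (fun n => th n * sin_exponent (v / th n)) =
    (fun n => \int[m]_t (th n * sin (v / th n * Y t))).
  by apply/funext => n; rewrite RintegralZl//; exact: integrable_sin_exponent.
have -> : 0 = \int[m]_t (0 : R) by rewrite Rintegral_cst// mul0r.
apply: (@dominated_cvgR _ _ _ m (fun n t => th n * sin (v / th n * Y t))
  (fun=> 0) (fun t => (1 + `|v|) * kappa t)).
- by move=> n; measurability.
- move=> t; apply: (@squeeze_cvgr _ _ _ _ (fun n => - th n) th) => //.
  + apply: nearW => n; have /andP[p _] := th01 n.
    rewrite -ler_norml normrM (gtr0_norm p) -[leRHS]mulr1.
    by rewrite ler_wpM2l ?sin_max// ltW.
  + by rewrite -oppr0; exact: cvgN.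
- exact: integrableZlR.
- move=> n t; have /andP[p q] := th01 n.
  rewrite normrM (gtr0_norm p).
  apply: (le_trans (ler_wpM2l (ltW p) (sin_exponent_le _ _))).
  rewrite mulrA ler_wpM2r// mulrDr mulr1 lerD//.
  by rewrite normrM normfV (gtr0_norm p) mulrCA mulfV ?mulr1// gt_eqF.
Qed.

End exponents.

(** * Small-time limits *)

Section small_time_limits.
Context {R : realType} {d : measure_display} {T : measurableType d}.
Variable m : {sigma_finite_measure set T -> \bar R}.
Variable Y : T -> R.
Local Notation mu := (@lebesgue_measure R).
Hypothesis mY : measurable_fun setT Y.
Hypothesis intY : m.-integrable setT (EFin \o (fun t => Num.min `|Y t| 1)).
Variables (beta : R) (th : nat -> R).
Hypothesis beta0 : 0 <= beta.
Hypothesis th01 : forall n, 0 < th n <= 1.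
Hypothesis th0 : th n @[n --> \oo] --> 0.
Local Notation a := (cos_exponent m Y).
Local Notation B := (fun u : R => beta * u + sin_exponent m Y u).

Let th_gt0 n : 0 < th n. Proof. by case/andP: (th01 n). Qed.
Let th_neq0 n : th n != 0. Proof. by rewrite gt_eqF. Qed.

Let C : R := beta + \int[m]_t Num.min `|Y t| 1.

Let C_ge0 : 0 <= C.
Proof.
by rewrite addr_ge0//; apply: Rintegral_ge0 => t _; rewrite le_min normr_ge0/=.
Qed.

Let B_bound u : `|B u| <= C * (1 + `|u|).
Proof.
rewrite (le_trans (ler_normD _ _))// /C mulrDl lerD ?sin_exponent_bound//.
rewrite normrM (ger0_norm beta0) ler_wpM2l//; lra.
Qed.

Let measurable_a : measurable_fun setT a.
Proof. exact: measurable_cos_exponent. Qed.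

Let measurable_B : measurable_fun setT B.
Proof. by measurability; exact: measurable_sin_exponent. Qed.

Let measurable_scaled (f : R -> R) (k : R) : measurable_fun setT f ->
  measurable_fun setT (fun u => f (k * u)).
Proof. by move=> mf; apply: (measurableT_comp mf); exact: (@mulrl_measurable R setT k). Qed.

Let subr_expRN_ge0 (z : R) : 0 <= z -> 0 <= 1 - expR (- z) <= z.
Proof.
move=> z0; rewrite subr_ge0 -[X in _ <= X]expR0 ler_expR oppr_le0 z0/=.
by have := expR_ge1Dx (- z); lra.
Qed.

(** The quotient [(1 - e^{-th a}) / th] tends to [a] and stays below it, the cosine tends to 1, and
    [a] is integrable against the weight. *)
Let cvg_jump_part eta : 0 < eta <= 1 ->
  \int[mu]_u ((1 - expR (- (th n * a (eta * u)))) / th n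
     * cos (th n * B (eta * u)) * (1 + u ^+ 2)^-1) @[n --> \oo] -->
  @cos_const R * \int[m]_t even_payoff (eta * Y t).
Proof.
move=> eta01.
have [ia <-] := cos_exponent_kernel mY intY eta01.
have ma := measurable_scaled eta measurable_a.
have mB := measurable_scaled eta measurable_B.
apply: (@dominated_cvgR _ _ _ mu (fun n u => (1 - expR (- (th n * a (eta * u)))) / th n
     * cos (th n * B (eta * u)) * (1 + u ^+ 2)^-1) _
   (fun u => a (eta * u) * (1 + u ^+ 2)^-1)) => //.
- by move=> n; measurability.
- move=> u; apply: cvgM; last exact: cvg_cst.
  rewrite -[X in _ --> X]mulr1; apply: cvgM.
    apply: (@is_derive0_cvg R (fun y => 1 - expR (- (y * a (eta * u))))) => //.
      by apply: is_derive_eq; rewrite mul0r oppr0 expR0 /GRing.scale/=; ring.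
    by rewrite mul0r oppr0 expR0 subrr.
  rewrite -(@cos0 R); apply: continuous_cvg; first exact: continuous_cos.
  by rewrite -(mul0r (B (eta * u))); apply: cvgM => //; exact: cvg_cst.
- move=> n u; rewrite normrM [X in _ * X]ger0_norm; last first.
    by rewrite invr_ge0 ltW// oneDsqr_pos.
  rewrite ler_wpM2r ?invr_ge0 ?(ltW (oneDsqr_pos _))//.
  rewrite normrM -[leRHS]mulr1 ler_pM ?cos_max//.
  have := cos_exponent_ge0 m Y (eta * u) => a0.
  have /andP[h1 h2] := subr_expRN_ge0 (mulr_ge0 (ltW (th_gt0 n)) a0).
  by rewrite ger0_norm ?divr_ge0 ?(ltW (th_gt0 n))// ler_pdivrMr// [leRHS]mulrC.
Qed.

(* The substitution [u = v / th n] turns this term into an integral whose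
   integrand converges to the one defining [cos_const]. *)
Let cvg_drift_part eta : 0 < eta <= 1 ->
  (th n)^-1 * \int[mu]_u ((1 - cos (th n * B (eta * u))) * (1 + u ^+ 2)^-1)
    @[n --> \oo] --> @cos_const R * (eta * beta).
Proof.
move=> /andP[e0 e1].
have mB := measurable_scaled eta measurable_B.
pose h n v := (1 - cos (th n * B (eta * ((th n)^-1 * v)))) / (th n ^+ 2 + v ^+ 2).
have -> : (fun n => (th n)^-1 *
    \int[mu]_u ((1 - cos (th n * B (eta * u))) * (1 + u ^+ 2)^-1)) =
    (fun n => \int[mu]_v h n v).
  apply/funext => n.
  have V0 : 0 < (th n)^-1 by rewrite invr_gt0.
  pose g u := (1 - cos (th n * B (eta * u))) * (1 + u ^+ 2)^-1.
  have ig : mu.-integrable setT (EFin \o g).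
    apply: (le_oneDsqrV_integrable (k := 2)); first by rewrite /g; measurability.
    move=> u; rewrite normrM [X in _ * X]ger0_norm; last first.
      by rewrite invr_ge0 ltW// oneDsqr_pos.
    rewrite ler_wpM2r ?invr_ge0 ?(ltW (oneDsqr_pos _))//.
    by rewrite ger0_norm ?subr_cos_ge0 ?subr_cos_le2.
  have ig' := integrable_scale V0 ig.
  rewrite (Rintegral_scale V0 ig) mulrA -RintegralZl//.
  apply: eq_Rintegral => v _; rewrite /g /h; set y := cos _.
  have p2 : th n ^+ 2 + v ^+ 2 != 0.
    by rewrite gt_eqF// ltr_pwDl ?sqr_ge0// exprn_gt0.
  by field; rewrite p2 th_neq0.
have eb0 : 0 <= eta * beta by rewrite mulr_ge0// ltW.
have <- : \int[mu]_v ((1 - cos (v * (eta * beta))) / v ^+ 2) =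
    @cos_const R * (eta * beta).
  by rewrite Rintegral_subr_cos ger0_norm.
apply: (@dominated_cvgR _ _ _ mu h _ (fun v => (2 * C ^+ 2 + 2) * (1 + v ^+ 2)^-1)).
- move=> n; rewrite /h; measurability.
  by apply: (measurable_scaled (f := fun y => sin_exponent m Y (eta * y)));
    apply: measurable_scaled; exact: measurable_sin_exponent.
(* At [v = 0] the limit integrand is 0 by the convention on division, and so is every term of the
   sequence. *)
- move=> v; have [->|v0] := eqVneq v 0.
    rewrite mul0r cos0 subrr mul0r /h.
    under eq_fun do rewrite !mulr0 /sin_exponent.
    have -> : \int[m]_t sin (0 * Y t) = 0.
      rewrite (@eq_Rintegral _ _ _ m setT (fun=> 0)) ?Rintegral_cst ?mul0r//.
      by move=> t _; rewrite mul0r sin0.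
    by under eq_fun do rewrite addr0 mulr0 cos0 subrr mul0r; exact: cvg_cst.
  apply: cvgM.
    apply: cvgB; first exact: cvg_cst.
    apply: continuous_cvg; first exact: continuous_cos.
    have -> : (fun n => th n * (beta * (eta * ((th n)^-1 * v)) +
        sin_exponent m Y (eta * ((th n)^-1 * v)))) =
        (fun n => v * (eta * beta) + th n * sin_exponent m Y (eta * v / th n)).
      apply/funext => n.
      have -> : eta * ((th n)^-1 * v) = eta * v / th n by rewrite mulrCA mulrC.
      by rewrite mulrDr; congr (_ + _); field; exact: th_neq0.
    rewrite -[X in _ --> X]addr0; apply: cvgD; first exact: cvg_cst.
    exact: sin_exponent_scale_cvg.
  apply: cvgV; first by rewrite sqrf_eq0.
  rewrite -[X in _ --> X]add0r; apply: cvgD; last exact: cvg_cst.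
  have -> : (fun n => th n ^+ 2) = (fun n => th n * th n).
    by apply/funext => n; rewrite expr2.
  by rewrite -(mul0r 0); exact: cvgM.
- exact: integrableZlR integrable_oneDsqrV.
- move=> n v; rewrite /h; set t := 1 - cos _.
  have t0 : 0 <= t by exact: subr_cos_ge0.
  have t2 : t <= 2 by exact: subr_cos_le2.
  have s0 : 0 < th n ^+ 2 + v ^+ 2 by rewrite ltr_pwDl ?sqr_ge0// exprn_gt0.
  (* Here [1 - cos z <= z^2] with [|z| <= C (th n + |v|)]; together with [t <= 2] this gives a
     majorant uniform in [n]. *)
  have tA : t <= 2 * C ^+ 2 * (th n ^+ 2 + v ^+ 2).
    rewrite (le_trans (subr_cos_le_sqr _))//.
    have : `|th n * B (eta * ((th n)^-1 * v))| <= C * (th n + `|v|).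
      rewrite normrM (gtr0_norm (th_gt0 n)).
      rewrite (le_trans (ler_wpM2l (ltW (th_gt0 n)) (B_bound _)))//.
      rewrite mulrCA ler_wpM2l// mulrDr mulr1 lerD2l !normrM normfV.
      rewrite (gtr0_norm (th_gt0 n)) (gtr0_norm e0) mulrCA mulVKf//.
      by rewrite ler_piMl.
    set z := th n * _ => zC.
    rewrite -[leLHS]real_normK ?num_real//.
    rewrite (@le_trans _ _ ((C * (th n + `|v|)) ^+ 2))//.
      by rewrite lerXn2r// nnegrE mulr_ge0// addr_ge0// ltW.
    rewrite exprMn [leRHS](_ : _ = C ^+ 2 * (2 * (th n ^+ 2 + v ^+ 2))); last by ring.
    rewrite ler_wpM2l ?sqr_ge0//.
    have := sqr_ge0 (th n - `|v|); rewrite sqrrB sqrrD real_normK ?num_real//; lra.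
  rewrite ger0_norm ?divr_ge0 ?(ltW s0)// ler_pdivrMr//.
  rewrite mulrAC ler_pdivlMr ?oneDsqr_pos//.
  have h1 := sqr_ge0 v; have h2 := sqr_ge0 (th n).
  have h3 : t * v ^+ 2 <= 2 * v ^+ 2 by rewrite ler_wpM2r.
  by rewrite mulrDr mulr1 [leRHS]mulrDl; lra.
Qed.

(** The splitting [1 - e k = (1 - e) k + (1 - k)], with [e] the exponential and [k] the cosine,
    separates the jump part from the drift part. *)
Lemma cos_exponent_cvg eta : 0 < eta <= 1 ->
  (th n)^-1 * \int[mu]_u ((1 - expR (- (th n * a (eta * u)))
     * cos (th n * B (eta * u))) * (1 + u ^+ 2)^-1) @[n --> \oo] -->
  @cos_const R * (\int[m]_t even_payoff (eta * Y t) + eta * beta).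
Proof.
move=> /[dup] eta01 /andP[e0 e1]; rewrite mulrDr.
have ma := measurable_scaled eta measurable_a.
have mB := measurable_scaled eta measurable_B.
have w0 u : 0 <= (1 + u ^+ 2)^-1 :> R by rewrite invr_ge0 ltW// oneDsqr_pos.
apply: cvg_trans (cvgD (cvg_jump_part eta01) (cvg_drift_part eta01)).
apply: near_eq_cvg; apply: nearW => n /=; rewrite fctE.
have i2 : mu.-integrable setT (EFin \o (fun u =>
    (1 - cos (th n * B (eta * u))) * (1 + u ^+ 2)^-1)).
  apply: (le_oneDsqrV_integrable (k := 2)); first by measurability.
  move=> u; rewrite normrM [X in _ * X]ger0_norm// ler_wpM2r//.
  by rewrite ger0_norm ?subr_cos_ge0 ?subr_cos_le2.
have i1 : mu.-integrable setT (EFin \o (fun u =>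
    (1 - expR (- (th n * a (eta * u)))) / th n
     * cos (th n * B (eta * u)) * (1 + u ^+ 2)^-1)).
  apply: (le_oneDsqrV_integrable (k := (th n)^-1)); first by measurability.
  move=> u; rewrite normrM [X in _ * X]ger0_norm// ler_wpM2r// normrM.
  rewrite -[leRHS]mulr1 ler_pM ?cos_max// normrM normfV (gtr0_norm (th_gt0 n)).
  rewrite -[leRHS]mul1r ler_wpM2r ?invr_ge0 ?(ltW (th_gt0 n))//.
  have /andP[h1 _] := subr_expRN_ge0
    (mulr_ge0 (ltW (th_gt0 n)) (cos_exponent_ge0 m Y (eta * u))).
  by rewrite ger0_norm// lerBlDr lerDl expR_ge0.
rewrite -RintegralZl// -RintegralD//; last exact: integrableZlR.
rewrite -RintegralZl//.
  apply: eq_Rintegral => u _; set e := expR _; set k := cos _; set w := (1 + _)^-1.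
  by field; exact: th_neq0.
apply: (le_oneDsqrV_integrable (k := 2)); first by measurability.
move=> u; rewrite normrM [X in _ * X]ger0_norm// ler_wpM2r//.
rewrite (le_trans (ler_normB _ _))// normr1 -[leRHS](@natrD _ 1 1) lerD2l normrM.
rewrite -[leRHS]mulr1 ler_pM ?cos_max// ger0_norm ?expR_ge0// -expR0 ler_expR.
by rewrite oppr_le0 mulr_ge0 ?cos_exponent_ge0// ltW.
Qed.

(** The quotient [sin (th B) / th] tends to [B] and is bounded by [|B|], which grows at most
    linearly and is integrable against [odd_weight]. *)
Lemma sin_exponent_cvg eta : 0 < eta < 1 ->
  (th n)^-1 * \int[mu]_u (expR (- (th n * a u)) * sin (th n * B u)
     * odd_weight eta u) @[n --> \oo] -->
  @cos_const R * (\int[m]_t odd_payoff (Y t) - \int[m]_t odd_payoff (eta * Y t)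
    + beta * (1 - eta)).
Proof.
move=> /[dup] eta01 /andP[e0 e1].
have mB := measurable_B; have ma := measurable_a.
have mb := @measurable_odd_weight R eta.
(* The linear part of [B] is integrated by [Rintegral_odd_weight], the jump part by
   [sin_exponent_kernel]. *)
have eE : @cos_const R * (\int[m]_t odd_payoff (Y t)
    - \int[m]_t odd_payoff (eta * Y t) + beta * (1 - eta)) =
    \int[mu]_u (B u * odd_weight eta u).
  rewrite mulrDr -sin_exponent_kernel// mulrCA -Rintegral_odd_weight//.
  have i1 : mu.-integrable setT (EFin \o (fun u => u * odd_weight eta u)).
    apply: (integrable_odd_weight (M := 1)) => //.
    by move=> u; rewrite mul1r; lra.
  have i2 : mu.-integrable setT
      (EFin \o (fun u => sin_exponent m Y u * odd_weight eta u)).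
    apply: (integrable_odd_weight (M := \int[m]_t Num.min `|Y t| 1)) => //.
      exact: measurable_sin_exponent.
    by move=> u; exact: sin_exponent_bound.
  rewrite -RintegralZl// -RintegralD//; last exact: integrableZlR.
  by apply: eq_Rintegral => u _; ring.
rewrite eE.
have iB : mu.-integrable setT (EFin \o (fun u => B u * odd_weight eta u)).
  exact: (integrable_odd_weight (M := C)).
have expR_le1 n u : `|expR (- (th n * a u))| <= 1.
  rewrite ger0_norm ?expR_ge0// -expR0 ler_expR oppr_le0.
  by rewrite mulr_ge0 ?cos_exponent_ge0// ltW.
have -> : (fun n => (th n)^-1 * \int[mu]_u (expR (- (th n * a u)) *
    sin (th n * B u) * odd_weight eta u)) =
    (fun n => \int[mu]_u (expR (- (th n * a u)) * (sin (th n * B u) / th n)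
      * odd_weight eta u)).
  apply/funext => n; rewrite -RintegralZl//.
    by apply: eq_Rintegral => u _; ring.
  apply: (integrable_odd_weight (g := fun u => expR (- (th n * a u)) *
    sin (th n * B u)) (M := 1)) => //; first by measurability.
  move=> u; rewrite normrM mul1r -[leRHS]mulr1; apply: ler_pM => //.
    by rewrite (le_trans (expR_le1 _ _))// lerDl.
  exact: sin_max.
apply: (@dominated_cvgR _ _ _ mu (fun n u => expR (- (th n * a u)) *
    (sin (th n * B u) / th n) * odd_weight eta u) _
    (fun u => `|B u * odd_weight eta u|)).
- by move=> n; measurability.
- move=> u; apply: cvgM; last exact: cvg_cst.
  rewrite -[X in _ --> X]mul1r; apply: cvgM.
    rewrite -(@expR0 R); apply: continuous_cvg; first exact: continuous_expR.
    rewrite -(@oppr0 R); apply: cvgN.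
    by rewrite -(mul0r (a u)); apply: cvgM => //; exact: cvg_cst.
  apply: (@is_derive0_cvg R (fun y => sin (y * B u)) (B u) th) => //.
    by apply: is_derive_eq; rewrite mul0r cos0 /GRing.scale/=; ring.
  by rewrite mul0r sin0.
- exact: integrable_norm iB.
- move=> n u; rewrite !normrM ler_wpM2r// -[leRHS]mul1r ler_pM//.
  rewrite normfV (gtr0_norm (th_gt0 n)) ler_pdivrMr// mulrC.
  by rewrite (le_trans (sin_le_normr _))// normrM (gtr0_norm (th_gt0 n)).
Qed.

End small_time_limits.

(** The scales [1 / (n + 2)] serve as [eta]; the shift by two keeps them strictly below 1. *)
Lemma even_payoff_cvg0 {R : realType} {d : measure_display} {T : measurableType d}
  (m : {sigma_finite_measure set T -> \bar R}) (Y : T -> R) :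
  measurable_fun setT Y ->
  m.-integrable setT (EFin \o (fun t => Num.min `|Y t| 1)) ->
  \int[m]_t even_payoff (n.+2%:R^-1 * Y t) @[n --> \oo] --> 0.
Proof.
move=> mY intY.
have -> : 0 = \int[m]_t (0 : R) by rewrite Rintegral_cst// mul0r.
apply: (@dominated_cvgR _ _ _ m (fun n t => even_payoff (n.+2%:R^-1 * Y t))
  (fun=> 0) _ _ _ intY).
- by move=> n; rewrite /even_payoff /put_payoff /posp; measurability.
- move=> t; apply: (@squeeze_cvgr _ _ _ _ (fun=> 0) (fun n => n.+1%:R^-1 * `|Y t|)).
  + apply: nearW => n; rewrite even_payoff_ge0/= (le_trans (even_payoff_le _))//.
    rewrite ge_min normrM ler_wpM2r// ger0_norm ?invr_ge0//.
    by rewrite lef_pV2 ?posrE// ler_nat.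
  + exact: cvg_cst.
  + rewrite -(mul0r `|Y t|); apply: cvgM; [exact: cvg_harmonic|exact: cvg_cst].
- move=> n t; rewrite ger0_norm ?even_payoff_ge0// (le_trans (even_payoff_le _))//.
  rewrite le_min !ge_min lexx orbT andbT normrM ger0_norm ?invr_ge0//.
  by rewrite ler_piMl// invf_le1// ler1n.
Qed.

(** Subtracting the odd estimate from the even one cancels [beta] up to [h * beta]. The terms [oh]
    and [onh] left over are controlled by [eh] and [enh], themselves small. *)
Lemma payoff_error_le {R : realType}
    (p e1 o1 eh oh pn en1 on1 enh onh beta h e : R) :
  2 * p = e1 - o1 -> 2 * pn = en1 - on1 -> `|oh| <= eh -> `|onh| <= enh ->
  0 <= h * beta -> `|e1 + beta - en1| <= e / 4 ->
  `|o1 - oh + beta * (1 - h) - (on1 - onh)| <= e / 4 ->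
  `|eh + h * beta - enh| <= e / 4 -> eh + h * beta <= e / 4 -> `|p - pn| <= e.
Proof. by rewrite mulrBr mulr1 [beta * h]mulrC !ler_norml; lra. Qed.

(** * Small-time limit of the expected put payoff *)

Section put_small_time.
Context {R : realType} {d : measure_display} {T : measurableType d}.
Variable m : {sigma_finite_measure set T -> \bar R}.
Variable Y : T -> R.
Hypothesis mY : measurable_fun setT Y.
Hypothesis intY : m.-integrable setT (EFin \o (fun t => Num.min `|Y t| 1)).
Variables (beta : R) (th : nat -> R).
Hypothesis beta0 : 0 <= beta.
Hypothesis th01 : forall n, 0 < th n <= 1.
Hypothesis th0 : th n @[n --> \oo] --> 0.
Context {d' : measure_display} {Omega : measurableType d'}.
Variables (P : probability Omega R) (Z : nat -> Omega -> R).
Hypothesis mZ : forall n, measurable_fun setT (Z n).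
Local Notation a := (cos_exponent m Y).
Local Notation B := (fun u : R => beta * u + sin_exponent m Y u).
(** With [Zsin], this says that [Z n] has the characteristic function at time [th n] of a finite
    variation Levy process with drift [beta] and jump measure the image of [m] under [Y]. *)
Hypothesis Zcos : forall n u, \int[P]_w cos (u * Z n w) =
  expR (- (th n * a u)) * cos (th n * B u).
Hypothesis Zsin : forall n u, \int[P]_w sin (u * Z n w) =
  expR (- (th n * a u)) * sin (th n * B u).
Local Notation c := (@cos_const R).
Local Notation mu := (@lebesgue_measure R).

Let c_neq0 : c != 0. Proof. by rewrite gt_eqF// cos_const_gt0. Qed.

Let cvg_mulKf (f : nat -> R) (l : R) :
  c * f n @[n --> \oo] --> c * l -> f n @[n --> \oo] --> l.
Proof.
move=> H; rewrite -[l](mulKf c_neq0).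
have -> : f = (fun n => c^-1 * (c * f n)) by apply/funext => n; rewrite mulKf.
by apply: cvgM H; exact: cvg_cst.
Qed.

Let bounded_integrable (f : Omega -> R) : measurable_fun setT f ->
  (forall w, `|f w| <= 1) -> P.-integrable setT (EFin \o f).
Proof.
move=> mf f1; apply: (@le_integrableR _ _ _ P f (fun=> 1)) => //.
exact: finite_measure_integrable_cst.
Qed.

Let intZ n : P.-integrable setT (EFin \o (fun w => Num.min `|Z n w| 1)).
Proof.
apply: bounded_integrable.
  by have mZn := mZ n; measurability.
by move=> w; rewrite ger0_norm ?ge_min ?lexx ?orbT// le_min normr_ge0/=.
Qed.

Let cos_exponentP n u :
  cos_exponent P (Z n) u = 1 - expR (- (th n * a u)) * cos (th n * B u).
Proof.
rewrite -Zcos /cos_exponent RintegralB//.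
- have PT : fine (P setT) = 1 by rewrite probability_setT.
  by rewrite Rintegral_cst// mul1r; congr (_ - _); exact: PT.
- exact: finite_measure_integrable_cst.
- apply: bounded_integrable => [|w]; last exact: cos_max.
  by have mZn := mZ n; measurability.
Qed.

(** Reading [cos_exponent_kernel] for [P] and [Z n] turns the Fourier integral of [cos_exponent_cvg]
    into an expectation. *)
Let even_cvg eta : 0 < eta <= 1 ->
  (th n)^-1 * \int[P]_w even_payoff (eta * Z n w) @[n --> \oo] -->
  \int[m]_t even_payoff (eta * Y t) + eta * beta.
Proof.
move=> eta01.
have := cos_exponent_cvg mY intY beta0 th01 th0 eta01.
have -> : (fun n => (th n)^-1 * \int[mu]_u ((1 - expR (- (th n * a (eta * u)))
     * cos (th n * B (eta * u))) * (1 + u ^+ 2)^-1)) =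
   (fun n => c * ((th n)^-1 * \int[P]_w even_payoff (eta * Z n w))).
  apply/funext => n; rewrite mulrCA.
  have [_ <-] := cos_exponent_kernel (mZ n) (intZ n) eta01.
  congr (_ * _); apply: eq_Rintegral => u _.
  by rewrite cos_exponentP.
exact: cvg_mulKf.
Qed.

(** The same transfer for the sine, by [sin_exponent_kernel] under [P]. *)
Let odd_cvg eta : 0 < eta < 1 ->
  (th n)^-1 * (\int[P]_w odd_payoff (Z n w) - \int[P]_w odd_payoff (eta * Z n w))
    @[n --> \oo] -->
  \int[m]_t odd_payoff (Y t) - \int[m]_t odd_payoff (eta * Y t) + beta * (1 - eta).
Proof.
move=> eta01.
have := sin_exponent_cvg mY intY beta0 th01 th0 eta01.
have -> : (fun n => (th n)^-1 * \int[mu]_u (expR (- (th n * a u))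
     * sin (th n * B u) * odd_weight eta u)) =
   (fun n => c * ((th n)^-1 * (\int[P]_w odd_payoff (Z n w)
      - \int[P]_w odd_payoff (eta * Z n w)))).
  apply/funext => n; rewrite mulrCA -(sin_exponent_kernel (mZ n) (intZ n) eta01).
  congr (_ * _); apply: eq_Rintegral => u _.
  by rewrite /sin_exponent Zsin.
exact: cvg_mulKf.
Qed.

Let put_split {d1 : measure_display} {T1 : measurableType d1}
    (m1 : {sigma_finite_measure set T1 -> \bar R}) (Y1 : T1 -> R) :
  measurable_fun setT Y1 ->
  m1.-integrable setT (EFin \o (fun t => Num.min `|Y1 t| 1)) ->
  2 * \int[m1]_t put_payoff (Y1 t) =
  \int[m1]_t even_payoff (1 * Y1 t) - \int[m1]_t odd_payoff (Y1 t).
Proof.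
move=> mY1 intY1.
have i1 : m1.-integrable setT (EFin \o (fun t => even_payoff (1 * Y1 t))).
  by apply: integrable_even_payoff; rewrite // ltr01 lexx.
have i2 : m1.-integrable setT (EFin \o (fun t => odd_payoff (Y1 t))).
  have := @integrable_odd_payoff R _ _ m1 Y1 mY1 intY1 1.
  by rewrite ltr01 lexx => /(_ isT); under eq_fun do rewrite /= mul1r.
rewrite -RintegralB// -RintegralZl//.
  by apply: eq_Rintegral => t _; rewrite mul1r put_payoffE.
apply: le_integrableR i1.
  by rewrite /put_payoff /posp; measurability.
move=> t; rewrite mul1r ger0_norm ?put_payoff_ge0// /even_payoff lerDl.
exact: put_payoff_ge0.
Qed.

Let odd_le {d1 : measure_display} {T1 : measurableType d1}
    (m1 : {sigma_finite_measure set T1 -> \bar R}) (Y1 : T1 -> R) eta :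
  measurable_fun setT Y1 ->
  m1.-integrable setT (EFin \o (fun t => Num.min `|Y1 t| 1)) -> 0 < eta <= 1 ->
  `|\int[m1]_t odd_payoff (eta * Y1 t)| <= \int[m1]_t even_payoff (eta * Y1 t).
Proof.
move=> mY1 intY1 eta01.
have i := integrable_odd_payoff mY1 intY1 eta01.
apply: (le_trans (le_normr_Rintegral measurableT i)).
apply: le_Rintegral => //; first exact: integrable_norm i.
  exact: integrable_even_payoff.
by move=> t _; exact: odd_payoff_le.
Qed.

(** The even limit is taken at scale 1 and the odd one as a difference between scales 1 and [eta];
    the even limit at scale [eta] bounds the odd term subtracted there. *)
Lemma put_payoff_small_time_cvg :
  (th n)^-1 * \int[P]_w put_payoff (Z n w) @[n --> \oo] -->
  \int[m]_t put_payoff (Y t).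
Proof.
apply/cvgrPdist_le => e e0.
(* The scale [eta] is fixed before [n], so small that the even limit at this scale is at most
   [e / 4]. *)
have [k Hk] : exists k, \int[m]_t even_payoff (k.+2%:R^-1 * Y t)
    + k.+2%:R^-1 * beta <= e / 4.
  have H : \int[m]_t even_payoff (n.+2%:R^-1 * Y t) + n.+2%:R^-1 * beta
      @[n --> \oo] --> (0 : R).
    rewrite -[X in _ --> X]addr0; apply: cvgD; first exact: even_payoff_cvg0.
    rewrite -(mul0r beta); apply: cvgM; last exact: cvg_cst.
    have := @cvg_harmonic R; rewrite -(cvg_shiftS (@harmonic R)).
    exact.
  have e4 : 0 < e / 4 by rewrite divr_gt0.
  move/cvgrPdist_le : H => /(_ _ e4)[N _ HN].
  by exists N; have := HN N (leqnn N); rewrite /= sub0r normrN => /(le_trans (ler_norm _)).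
set eta := k.+2%:R^-1 in Hk.
have eta01 : 0 < eta < 1.
  by rewrite /eta invr_gt0 ltr0n/= invf_lt1 ?ltr0n// ltr1n.
have eta01' : 0 < eta <= 1 by case/andP: eta01 => -> /ltW ->.
have one01 : 0 < (1 : R) <= 1 by rewrite ltr01 lexx.
have e4 : 0 < e / 4 by rewrite divr_gt0.
have /cvgrPdist_le/(_ _ e4) H1 := even_cvg one01.
have /cvgrPdist_le/(_ _ e4) H2 := odd_cvg eta01.
have /cvgrPdist_le/(_ _ e4) H3 := even_cvg eta01'.
have splitY := put_split mY intY; have oddY := odd_le mY intY eta01'.
move: H1 H2 H3; apply: filterS3 => n A1 A2 A3.
have splitZ := put_split (mZ n) (intZ n); have oddZ := odd_le (mZ n) (intZ n) eta01'.
have t0 : 0 < (th n)^-1 by rewrite invr_gt0; case/andP: (th01 n).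
have {}splitZ : 2 * ((th n)^-1 * \int[P]_w put_payoff (Z n w)) =
    (th n)^-1 * \int[P]_w even_payoff (1 * Z n w) -
    (th n)^-1 * \int[P]_w odd_payoff (Z n w).
  by rewrite mulrCA splitZ mulrBr.
have {}oddZ : `|(th n)^-1 * \int[P]_w odd_payoff (eta * Z n w)| <=
    (th n)^-1 * \int[P]_w even_payoff (eta * Z n w).
  by rewrite normrM (gtr0_norm t0) ler_wpM2l// ltW.
have eb : 0 <= eta * beta by rewrite mulr_ge0//; case/andP: eta01 => /ltW.
rewrite [X in `|_ - X|]mulrBr in A2; rewrite mul1r in A1.
exact: (payoff_error_le splitY splitZ oddY oddZ eb A1 A2 A3 Hk).
Qed.

End put_small_time.

(** * Critical price *)

(** By Markov's inequality each set [f >= 1 / (n + 1)] has finite measure, and with the null set [N]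
    these cover the space. *)
Lemma integrable_pos_sigma_finite {R : realType} {d : measure_display}
  {T : measurableType d} (m : {measure set T -> \bar R}) (f : T -> R) (N : set T) :
  measurable N -> m N = 0%E -> m.-integrable setT (EFin \o f) ->
  (forall x, 0 <= f x) -> (forall x, ~ N x -> 0 < f x) -> sigma_finite setT m.
Proof.
move=> mN N0 intf f0 fpos.
have mf : measurable_fun setT f by exact/measurable_EFinP/(measurable_int m intf).
pose A n : set T := [set x | n.+1%:R^-1 <= f x].
have mA n : measurable (A n).
  have -> : A n = setT `&` f @^-1` `[n.+1%:R^-1, +oo[%classic.
    by rewrite setTI; apply/seteqP; split => x /=; rewrite in_itv/= andbT.
  exact: mf.
exists (fun n => A n `|` N).
  apply/seteqP; split => // x _.
  have [Nx|Nx] := pselect (N x); first by exists 0%N => //; right.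
  have [n /ltW xn] := ltr_add_invr (fpos _ Nx).
  by exists n => //; left; rewrite /A/= -[leLHS]add0r.
move=> n; split; first exact: measurableU.
apply: (le_lt_trans (measureU2 m (mA n) mN)).
rewrite [X in (_ + X)%E](_ : _ = 0%E) ?adde0//.
have cA : ((n.+1%:R^-1)%:E * m (A n) < +oo)%E.
  rewrite -integral_cst//.
  apply: (@le_lt_trans _ _ (\int[m]_x (f x)%:E)%E); last first.
    by rewrite (integral_RintegralE intf) ltry.
  apply: (@le_trans _ _ (\int[m]_(x in A n) (f x)%:E)%E).
    apply: ge0_le_integral => //.
      by move=> x _; rewrite lee_fin invr_ge0.
    by apply/measurable_EFinP/measurable_funTS.
  apply: ge0_subset_integral => //; first exact/measurable_EFinP.
  by move=> x _; rewrite lee_fin.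
have aux (k : R) (y : \bar R) : 0 < k -> (0 <= y -> k%:E * y < +oo -> y < +oo)%E.
  move=> k0; case: y => [r _ _|_|].
  - exact: ltry.
  - by rewrite gt0_muley// lte_fin.
  - by rewrite leeNy_eq.
by apply: aux cA; rewrite ?invr_gt0 ?measure_ge0.
Qed.

Lemma is_derive0_cvg_right {R : realType} (F : R -> R) (l : R) :
  is_derive (0 : R) (1 : R) F l -> F 0 = 0 -> F t / t @[t --> 0^'+] --> l.
Proof.
move=> dF F0; apply/cvg_at_rightP => u [u0 ucvg].
by apply: is_derive0_cvg => // n; rewrite gt_eqF.
Qed.

(** A sequence tending to 0 is eventually below 1, and dropping its first terms leaves the limit
    unchanged. *)
Lemma cvg_right0_le1P {R : realType} (f : R -> R) (l : R) :
  (forall th : nat -> R, (forall n, 0 < th n <= 1) ->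
    th n @[n --> \oo] --> 0 -> f (th n) @[n --> \oo] --> l) ->
  f t @[t --> 0^'+] --> l.
Proof.
move=> H; apply/cvg_at_rightP => u [u0 ucvg].
have /cvgrPdist_le/(_ 1 ltr01)[N _ HN] := ucvg.
have uN n : 0 < u (n + N)%N <= 1.
  rewrite u0/=; have := HN (n + N)%N (leq_addl _ _).
  by rewrite /= sub0r normrN gtr0_norm.
have ucvgN : u (n + N)%N @[n --> \oo] --> 0 by rewrite (cvg_shiftn N u).
by rewrite -(cvg_shiftn N (fun n => f (u n))); exact: (H _ uN ucvgN).
Qed.

Lemma cvg_left_sub {R : realType} (T : R) : (T - t) @[t --> T^'-] --> 0^'+.
Proof.
move=> A /= [e /= e0 Ae]; exists e => //= t te tT.
by apply: Ae; rewrite /= ?subr_gt0// sub0r normrN.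
Qed.

Section critical_price.
Context {R : realType} {d : measure_display} {Omega : measurableType d}.
Variables (P : probability Omega R) (W : Omega -> R) (K D : R).
Hypothesis mW : measurable_fun setT W.
Hypothesis K0 : 0 < K.
Hypothesis D01 : 0 < D <= 1.

Let put x := \int[P]_w (D * posp (K - x * expR (W w))).

Let D_ge0 : 0 <= D. Proof. by case/andP: D01 => /ltW. Qed.
Let D_le1 : D <= 1. Proof. by case/andP: D01. Qed.

Let posp_ge0 (y : R) : 0 <= posp y.
Proof. by rewrite /posp le_max lexx orbT. Qed.

Let posp_le x w : 0 <= x -> posp (K - x * expR (W w)) <= K.
Proof.
move=> x0; rewrite /posp ge_max (ltW K0) andbT lerBlDr lerDl.
by rewrite mulr_ge0 ?expR_ge0.
Qed.

Let integrable_cstP k : P.-integrable setT (EFin \o (fun=> k : R)).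
Proof. exact: finite_measure_integrable_cst. Qed.

Let integrable_put x : 0 <= x ->
  P.-integrable setT (EFin \o (fun w => D * posp (K - x * expR (W w)))).
Proof.
move=> x0; apply: le_integrableR (integrable_cstP K).
  by rewrite /posp; measurability.
move=> w; rewrite ger0_norm ?mulr_ge0//.
by rewrite -[leRHS]mul1r ler_pM// posp_le.
Qed.

(** The price is convex in the spot and at most [K] at spot 0, so lying below the line [K - z] at
    [y] forces it below on [[0, y]]. *)
Lemma put_convex x y : 0 < y -> put y <= K - y -> 0 <= x <= y -> put x <= K - x.
Proof.
move=> y0 puty /andP[x0 xy].
have s0 : 0 <= x / y by rewrite divr_ge0// ltW.
have s1 : x / y <= 1 by rewrite ler_pdivrMr// mul1r.
have PT k : \int[P]_w (k : R) = k.
  rewrite Rintegral_cst//.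
  have -> : fine (P setT) = 1 by rewrite probability_setT.
  by rewrite mulr1.
have iy := integrable_put (ltW y0).
have i1 := integrable_cstP ((1 - x / y) * K).
have i2 := integrableZlR (x / y) iy.
have le1 : put x <= (1 - x / y) * K + x / y * put y.
  rewrite -[X in X + _]PT -(RintegralZl _ measurableT iy) -RintegralD//.
  apply: le_Rintegral => //; first exact: integrable_put.
    exact: (integrableDR i1 i2).
  move=> w _; set e := expR (W w).
  have p1 : posp (K - x * e) <= (1 - x / y) * K + x / y * posp (K - y * e).
    rewrite {1}/posp ge_max; apply/andP; split; last first.
      apply: addr_ge0; apply: mulr_ge0; rewrite ?subr_ge0 ?posp_ge0//.
      exact: ltW.
    have : x / y * (K - y * e) <= x / y * posp (K - y * e).
      by rewrite ler_wpM2l// /posp le_max lexx.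
    have -> : x / y * (K - y * e) = x / y * K - x * e by field; rewrite gt_eqF.
    lra.
  apply: (le_trans (ler_wpM2l D_ge0 p1)); rewrite mulrDr lerD//.
    by rewrite -[leRHS]mul1r ler_wpM2r// mulr_ge0 ?subr_ge0// ltW.
  by rewrite mulrCA.
apply: (le_trans le1).
have := ler_wpM2l s0 puty; rewrite mulrBr divfK ?gt_eqF//; lra.
Qed.

(** By [put_convex] no spot below [y] belongs to the set, whereas [x] does. *)
Lemma critical_price_bounds x y : 0 < y ->
  0 <= x -> posp (K - x) < put x -> put y <= K - y ->
  y <= inf [set z | 0 <= z /\ posp (K - z) < put z] <= x.
Proof.
move=> y0 x0 px py; apply/andP; split.
  apply: lb_le_inf; first by exists x.
  move=> z /= [z0 pz]; rewrite leNgt; apply/negP => zy.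
  have := put_convex y0 py; move=> /(_ z); rewrite z0 (ltW zy) => /(_ isT).
  apply/negP; rewrite -ltNge (le_lt_trans _ pz)// /posp le_max lexx//.
apply: ge_inf; last by [].
by exists 0 => z /= [].
Qed.

Lemma put_payoff_scale c : put (K * expR (- c)) =
  D * K * \int[P]_w put_payoff (W w - c).
Proof.
rewrite -RintegralZl//; last first.
  apply: le_integrableR (integrable_cstP 1).
    by rewrite /put_payoff /posp; measurability.
  by move=> w; rewrite ger0_norm ?put_payoff_ge0 ?put_payoff_le1.
apply: eq_Rintegral => w _; rewrite -[RHS]mulrA; congr (_ * _).
rewrite /put_payoff /posp maxr_pMr ?(ltW K0)// mulr0; congr Num.max.
by rewrite expRD; ring.
Qed.

(** For [c1] the exercise value is bounded by [1 - e^{-c1} <= c1]; for [c2] the discount factor is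
    bounded by 1. *)
Lemma critical_price_exp_bounds c1 c2 : 0 < c1 ->
  c1 < D * \int[P]_w put_payoff (W w - c1) ->
  \int[P]_w put_payoff (W w - c2) <= 1 - expR (- c2) ->
  K * expR (- c2) <= inf [set z | 0 <= z /\ posp (K - z) < put z]
    <= K * expR (- c1).
Proof.
move=> c10 A1 A2; apply: critical_price_bounds.
- by rewrite mulr_gt0 ?expR_gt0.
- by rewrite mulr_ge0 ?expR_ge0// ltW.
- rewrite put_payoff_scale mulrAC [ltRHS]mulrC /posp gt_max; apply/andP; split.
    rewrite -{1}(mulr1 K) -mulrBr ltr_pM2l// (le_lt_trans _ A1)//.
    by have := expR_ge1Dx (- c1); lra.
  by rewrite mulr_gt0// (lt_trans c10).
- rewrite put_payoff_scale mulrAC [leLHS]mulrC -{2}(mulr1 K) -mulrBr.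
  rewrite ler_wpM2l ?(ltW K0)// (le_trans _ A2)// -[leRHS]mul1r ler_wpM2r//.
  by apply: Rintegral_ge0 => w _; exact: put_payoff_ge0.
Qed.

End critical_price.

(** * Levy measures of finite variation *)

Lemma measurable_set_ler {R : realType} {d : measure_display} {T : measurableType d}
  (f g : T -> R) : measurable_fun setT f -> measurable_fun setT g ->
  measurable [set x | f x <= g x].
Proof.
move=> mf mg.
have -> : [set x | f x <= g x] = setT `&` (fun x => g x - f x) @^-1` `[0, +oo[%classic.
  by rewrite setTI; apply/seteqP; split => x /=; rewrite in_itv/= andbT subr_ge0.
by apply: (_ : measurable_fun setT (fun x => g x - f x)) => //; measurability.
Qed.

Lemma ge0_integrable_indic {R : realType} {d : measure_display} {T : measurableType d}
  (m : {measure set T -> \bar R}) (A : set T) (f : T -> R) :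
  measurable A -> measurable_fun setT f -> (forall x, 0 <= f x) ->
  (\int[m]_(x in A) (f x)%:E < +oo)%E ->
  m.-integrable setT (EFin \o (fun x => f x * \1_A x)).
Proof.
move=> mA mf f0 fy; apply: ge0_integrableR.
- by measurability; exact: measurable_indic.
- by move=> x; rewrite mulr_ge0.
- rewrite (_ : (\int[m]_x _)%E = (\int[m]_(x in A) (f x)%:E)%E)//.
  rewrite [RHS]integral_mkcond; apply: eq_integral => x _.
  by rewrite patchE indicE; case: ifPn => _; rewrite ?mulr1 ?mulr0.
Qed.

Section levy_finite_variation.
Context {R : realType}.
Variable nu : {sigma_finite_measure set (measurableTypeR R) -> \bar R}.
Hypothesis levy_nu : is_levy_measure nu.
Hypothesis exp_moment :
  (\int[nu]_(x in [set x : measurableTypeR R | (1 <= `|x|)%R]) (expR x)%:E < +oo)%E.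
Hypothesis finite_variation :
  (\int[nu]_(x in [set x : measurableTypeR R | (`|x| <= 1)%R]) (`|x|)%:E < +oo)%E.
Local Notation id := (fun x : measurableTypeR R => x : R).
Local Notation lam := (\int[nu]_(y in setT) negp (expR y - 1)).
Local Notation Ip := (\int[nu]_(y in setT) posp (expR y - 1)).

Let small : set (measurableTypeR R) := [set x | (`|x| <= 1)%R].
Let large : set (measurableTypeR R) := [set x | (1 <= `|x|)%R].

Let measurable_small : measurable small.
Proof. by apply: measurable_set_ler; measurability. Qed.

Let measurable_large : measurable large.
Proof. by apply: measurable_set_ler; measurability. Qed.

(** Small jumps are handled by finite variation, and for large ones [min(|x|, 1) = min(x^2, 1)]. *)
Lemma integrable_min_norm1 :
  nu.-integrable setT (EFin \o (fun x => Num.min `|id x| 1)).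
Proof.
have [_ i2] := levy_nu.
have i1 : nu.-integrable setT (EFin \o (fun x => `|id x| * \1_small x)).
  by apply: ge0_integrable_indic => //; measurability.
apply: le_integrableR (integrableDR i1 i2); first by measurability.
move=> x; rewrite ger0_norm ?le_min ?normr_ge0//=.
rewrite indicE /small; have [x1|x1] := leP `|x| 1.
  rewrite mem_set//= mulr1 lerDl le_min ler01 andbT sqr_ge0//.
rewrite memNset/=; last by apply/negP; rewrite -ltNge.
rewrite mulr0 add0r le_min lexx andbT -real_normK ?num_real//.
by rewrite exprn_ege1// ltW.
Qed.

(** The majorant is [e min(|x|, 1)] plus [e^x] on large jumps; for [0 < x < 1] it rests on
    [e^x - 1 <= x e^x]. *)
Let integrable_posp : nu.-integrable setT (EFin \o (fun y => posp (expR (id y) - 1))).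
Proof.
have i1 : nu.-integrable setT (EFin \o (fun x => expR (id x) * \1_large x)).
  exact: ge0_integrable_indic.
apply: le_integrableR (integrableDR (integrableZlR (expR 1) integrable_min_norm1) i1).
  by rewrite /posp; measurability.
move=> x; have p0 : 0 <= posp (expR x - 1) by rewrite /posp le_max lexx orbT.
rewrite ger0_norm// /posp ge_max; apply/andP; split; last first.
  by rewrite addr_ge0 ?mulr_ge0 ?expR_ge0 ?le_min ?normr_ge0//=.
have m0 : 0 <= Num.min `|x| 1 by rewrite le_min normr_ge0/=.
rewrite indicE /large; have [x1|x1] := leP 1 `|x|.
  rewrite mem_set//= !mulr1.
  by have := expR_ge0 (1 : R); lra.
rewrite memNset/=; last by apply/negP; rewrite -ltNge.
rewrite mulr0 addr0; have [x0|x0] := leP x 0.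
  apply: (@le_trans _ _ 0); last by rewrite mulr_ge0 ?expR_ge0.
  by rewrite subr_le0 -expR0 ler_expR.
rewrite gtr0_norm//.
have h1 : expR x - 1 <= expR x * x.
  have := expR_ge1Dx (- x); rewrite expRN => h.
  have := ler_wpM2l (expR_ge0 x) h; rewrite mulfV ?gt_eqF ?expR_gt0//; lra.
apply: (le_trans h1); rewrite ler_wpM2r ?(ltW x0)// ler_expR.
by move: x1; rewrite gtr0_norm// => /ltW.
Qed.

Lemma negp_put_payoff (y : R) : negp (expR y - 1) = put_payoff y.
Proof. by rewrite /negp /put_payoff /posp opprB. Qed.

Let integrable_negp : nu.-integrable setT (EFin \o (fun y => negp (expR (id y) - 1))).
Proof.
apply: le_integrableR integrable_min_norm1; first by rewrite /negp; measurability.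
move=> x; rewrite negp_put_payoff ger0_norm ?put_payoff_ge0//.
by rewrite le_min put_payoff_le_norm put_payoff_le1.
Qed.

Let trunc (x : measurableTypeR R) : R := if `|x| <= 1 then x else 0.

Let truncE x : trunc x = id x * \1_small x.
Proof.
rewrite /trunc indicE /small; case: ifPn => x1.
  by rewrite mem_set//= mulr1.
by rewrite memNset/= ?mulr0//; exact/negP.
Qed.

Let measurable_trunc : measurable_fun setT trunc.
Proof.
have -> : trunc = (fun x => id x * \1_small x) by apply/funext => x; exact: truncE.
by measurability; exact: measurable_indic.
Qed.

Let integrable_trunc : nu.-integrable setT (EFin \o trunc).
Proof.
apply: le_integrableR integrable_min_norm1 => // x; rewrite /trunc.
case: ifPn => [x1|_]; first by rewrite le_min lexx.
by rewrite normr0 le_min normr_ge0/=.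
Qed.

Lemma levy_re_exponent u : levy_re 0 nu u = - cos_exponent nu id u.
Proof.
rewrite /levy_re /cos_exponent expr0n/= mul0r oppr0 mul0r add0r -[RHS]mulN1r.
rewrite -RintegralZl//; last first.
  by apply: integrable_cos_exponent; [measurability|exact: integrable_min_norm1].
by apply: eq_Rintegral => x _; ring.
Qed.

(** The martingale condition gives [gamma] as [lam - Ip] plus the integral of the truncation, which
    cancels the compensator; the drift of [X] is thus [lam - Ip]. *)
Lemma levy_im_exponent gamma u :
  gamma + \int[nu]_(x in setT) (expR x - 1 - (if `|x| <= 1 then x else 0)) = 0 ->
  levy_im gamma nu u = (lam - Ip) * u + sin_exponent nu id u.
Proof.
have -> : \int[nu]_(x in setT) (expR x - 1 - (if `|x| <= 1 then x else 0)) =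
    Ip - lam - \int[nu]_x trunc x.
  rewrite -RintegralB// -RintegralB//; last exact: integrableBR.
  apply: eq_Rintegral => x _; rewrite /trunc; congr (_ - _).
  have [h|/ltW h] := leP 0 (expR x - 1); rewrite /posp /negp.
    by rewrite max_l// max_r ?subr0// oppr_le0.
  by rewrite max_r// max_l ?oppr_ge0// sub0r opprK.
rewrite /levy_im.
have -> : \int[nu]_(x in setT) (sin (u * x) - (if `|x| <= 1 then u * x else 0)) =
    sin_exponent nu id u - u * \int[nu]_x trunc x.
  have isin : nu.-integrable setT (EFin \o (fun x => sin (u * id x))).
    by apply: integrable_sin_exponent; [measurability|exact: integrable_min_norm1].
  rewrite -RintegralZl// -RintegralB//; last exact: integrableZlR.
  apply: eq_Rintegral => x _; rewrite /trunc; congr (_ - _).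
  by case: ifPn => // _; rewrite mulr0.
move=> H; have -> : gamma = lam - Ip + \int[nu]_x trunc x by move: H; lra.
by ring.
Qed.

Lemma negp_integral_gt0 : (0 < nu [set x : measurableTypeR R | (x < 0)%R])%E \/
   (\int[nu]_(x in [set x : measurableTypeR R | (0 < x)%R]) (Num.min x 1)%R%:E = +oo)%E ->
  0 < lam.
Proof.
pose N : set (measurableTypeR R) := [set x | (x < 0)%R].
have mN : measurable N.
  have -> : N = ~` [set x : measurableTypeR R | (0 <= x)%R].
    by apply/seteqP; split => x; rewrite /N/= ltNge => /negP.
  by apply: measurableC; apply: measurable_set_ler; measurability.
have f0 (x : R) : 0 <= negp (expR x - 1).
  by rewrite negp_put_payoff put_payoff_ge0.
have mf : measurable_fun setT (fun x : measurableTypeR R => negp (expR x - 1)).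
  by rewrite /negp; measurability.
case=> [N0|Iy]; last first.
  exfalso.
  have : (\int[nu]_(x in [set x : measurableTypeR R | (0 < x)%R]) (Num.min x 1)%R%:E
      <= \int[nu]_x (Num.min `|id x| 1)%:E)%E.
    have mpos : measurable [set x : measurableTypeR R | (0 < x)%R].
      have -> : [set x : measurableTypeR R | (0 < x)%R] =
          ~` [set x : measurableTypeR R | (x <= 0)%R].
        by apply/seteqP; split => x /=; rewrite ltNge => /negP.
      by apply: measurableC; apply: measurable_set_ler; measurability.
    apply: (@le_trans _ _ (\int[nu]_(x in [set x : measurableTypeR R | (0 < x)%R])
        (Num.min `|id x| 1)%:E)%E).
      rewrite le_eqVlt; apply/orP; left; apply/eqP.
      by apply: eq_integral => x; rewrite inE/= => x0; rewrite gtr0_norm.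
    apply: ge0_subset_integral => //.
    by apply/measurable_EFinP; measurability.
  by rewrite Iy (integral_RintegralE integrable_min_norm1) leye_eq.
have l0 : 0 <= lam by apply: Rintegral_ge0 => x _; exact: f0.
rewrite lt_neqAle l0 andbT; apply/eqP => lam0.
have I0 : (\int[nu]_x (negp (expR (id x) - 1))%:E = 0)%E.
  by rewrite (integral_RintegralE integrable_negp) -lam0.
have mE : measurable_fun setT
    (fun x : measurableTypeR R => (negp (expR (id x) - 1))%:E).
  exact/measurable_EFinP.
have [H _] := @ae_eq_integral_abs _ _ _ nu setT measurableT _ mE.
have [|Z [mZ Z0 NZ]] := H.
  by under eq_integral do rewrite /= ger0_norm//.
have : (nu N <= nu Z)%E.
  apply: le_measure; rewrite ?inE// => x Nx; apply: NZ => /= /(_ I)[].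
  rewrite negp_put_payoff put_payoff_neg ?(ltW Nx)// => /eqP.
  by rewrite subr_eq0 -expR0 eq_sym => /eqP/expR_inj x0; move: Nx; rewrite /N/= x0 ltxx.
by rewrite Z0 leNgt N0.
Qed.

End levy_finite_variation.

(** * Small-time put payoff of the Levy process *)

Section levy_put_small_time.
Context {R : realType} {d : measure_display} {Omega : measurableType d}.
Variables (P : probability Omega R) (X : R -> Omega -> R) (gamma : R).
Variable nu : {sigma_finite_measure set (measurableTypeR R) -> \bar R}.
Hypothesis levyX : levy_process P X 0 gamma nu.
Hypothesis exp_moment :
  (\int[nu]_(x in [set x : measurableTypeR R | (1 <= `|x|)%R]) (expR x)%:E < +oo)%E.
Hypothesis martingale :
  gamma + \int[nu]_(x in setT) (expR x - 1 - (if `|x| <= 1 then x else 0)) = 0.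
Hypothesis finite_variation :
  (\int[nu]_(x in [set x : measurableTypeR R | (`|x| <= 1)%R]) (`|x|)%:E < +oo)%E.
Local Notation id := (fun x : measurableTypeR R => x : R).
Local Notation lam := (\int[nu]_(y in setT) negp (expR y - 1)).
Local Notation Ip := (\int[nu]_(y in setT) posp (expR y - 1)).

(** Adding [b * t] to [X t] rotates the characteristic function, by the addition formulas, and
    changes the drift to [b + (lam - Ip)]. *)
Lemma levy_put_small_time b : 0 <= b + (lam - Ip) ->
  t^-1 * \int[P]_w put_payoff (b * t + X t w) @[t --> 0^'+] --> lam.
Proof.
move=> beta0; have [levy_nu charX] := levyX.
apply: cvg_right0_le1P => th th01 th0.
have imin := integrable_min_norm1 levy_nu finite_variation.
have -> : lam = \int[nu]_x put_payoff (id x).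
  by apply: eq_Rintegral => x _; rewrite negp_put_payoff.
have mX n : measurable_fun setT (X (th n)).
  by have [] := charX (th n) (ltW (proj1 (andP (th01 n)))).
have charE n (u : R) :
    \int[P]_w cos (u * X (th n) w) = expR (- (th n * cos_exponent nu id u)) *
      cos (th n * ((lam - Ip) * u + sin_exponent nu id u)) /\
    \int[P]_w sin (u * X (th n) w) = expR (- (th n * cos_exponent nu id u)) *
      sin (th n * ((lam - Ip) * u + sin_exponent nu id u)).
  have [_ /(_ u)] := charX (th n) (ltW (proj1 (andP (th01 n)))).
  by rewrite levy_re_exponent// (levy_im_exponent _ _ _ _ martingale)// mulrN.
have bounded_int (f : Omega -> R) : measurable_fun setT f ->
    (forall w, `|f w| <= 1) -> P.-integrable setT (EFin \o f).
  move=> mf f1; apply: (@le_integrableR _ _ _ P f (fun=> 1)) => //.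
  exact: finite_measure_integrable_cst.
have icos n u : P.-integrable setT (EFin \o (fun w => cos (u * X (th n) w))).
  apply: bounded_int => [|w]; last exact: cos_max.
  by have mXn := mX n; measurability.
have isin n u : P.-integrable setT (EFin \o (fun w => sin (u * X (th n) w))).
  apply: bounded_int => [|w]; last exact: sin_max.
  by have mXn := mX n; measurability.
apply: (@put_payoff_small_time_cvg R _ _ nu id _ imin (b + (lam - Ip)) th
    beta0 th01 th0 _ _ P (fun n w => b * th n + X (th n) w)).
- by measurability.
- by move=> n; have mXn := mX n; measurability.
- move=> n u; have [ec es] := charE n u.
  under eq_Rintegral do rewrite mulrDr cosD.
  rewrite RintegralB//; [|exact: integrableZlR|exact: integrableZlR].
  rewrite !RintegralZl// ec es.
  have -> : th n * ((b + (lam - Ip)) * u + sin_exponent nu id u) =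
    u * (b * th n) + th n * ((lam - Ip) * u + sin_exponent nu id u) by ring.
  by rewrite cosD; ring.
- move=> n u; have [ec es] := charE n u.
  under eq_Rintegral do rewrite mulrDr sinD.
  rewrite RintegralD//; [|exact: integrableZlR|exact: integrableZlR].
  rewrite !RintegralZl// ec es.
  have -> : th n * ((b + (lam - Ip)) * u + sin_exponent nu id u) =
    u * (b * th n) + th n * ((lam - Ip) * u + sin_exponent nu id u) by ring.
  by rewrite sinD; ring.
Qed.

End levy_put_small_time.

(** * Asymptotics of the critical price *)

Lemma critical_price_sandwich {R : realType} (K b c1 c2 th : R) :
  0 < K -> 0 < th -> K * expR (- (c2 * th)) <= b <= K * expR (- (c1 * th)) ->
  c1 <= (K / b - 1) / th <= (expR (c2 * th) - 1) / th.
Proof.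
move=> K0 th0 /andP[b2 b1].
have b0 : 0 < b by rewrite (lt_le_trans _ b2)// mulr_gt0 ?expR_gt0.
have e1 : expR (c1 * th) <= K / b.
  rewrite ler_pdivlMr// mulrC -ler_pdivlMr ?expR_gt0//.
  by rewrite -expRN.
have e2 : K / b <= expR (c2 * th).
  rewrite ler_pdivrMr// mulrC -ler_pdivrMr ?expR_gt0//.
  by rewrite -expRN.
rewrite ler_pdivlMr// ler_pM2r ?invr_gt0//; apply/andP; split; last by lra.
by have := expR_ge1Dx (c1 * th); lra.
Qed.

(** At spot [K e^{-c t}], with [t] the time to maturity, exercise is worth about [K c t] and the put
    about [K lam t], so the critical spot lies between those for exponents just above and just below
    [lam]. *)
Lemma sigma_finite_euro_crit_cvg (R : realType) (d : measure_display)
  (Omega : measurableType d) (P : probability Omega R) (X : R -> Omega -> R)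
  (gamma : R) (nu : {sigma_finite_measure set (measurableTypeR R) -> \bar R})
  (T K r delta : R) :
  levy_process P X 0 gamma nu -> 0 < K -> 0 < r ->
  (\int[nu]_(x in [set x : measurableTypeR R | (1 <= `|x|)%R]) (expR x)%:E < +oo)%E ->
  gamma + \int[nu]_(x in setT) (expR x - 1 - (if `|x| <= 1 then x else 0)) = 0 ->
  ((0 < nu [set x : measurableTypeR R | (x < 0)%R])%E \/
   (\int[nu]_(x in [set x : measurableTypeR R | (0 < x)%R]) (Num.min x 1)%R%:E = +oo)%E) ->
  (\int[nu]_(x in [set x : measurableTypeR R | (`|x| <= 1)%R]) (`|x|)%:E < +oo)%E ->
  0 < r - delta - \int[nu]_(y in setT) posp (expR y - 1) ->
  (fun t => (K / euro_crit P X T K r delta t - 1) / (T - t)) @ T^'-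
    --> \int[nu]_(y in setT) negp (expR y - 1).
Proof.
move=> levyX K0 r0 exp_moment martingale nondeg finvar dplus.
set lam := \int[nu]_(y in setT) negp (expR y - 1).
set Ip := \int[nu]_(y in setT) posp (expR y - 1) in dplus.
have [levy_nu charX] := levyX.
have lam0 : 0 < lam by exact: negp_integral_gt0.
pose Phi c t := \int[P]_w put_payoff ((r - delta - c) * t + X t w).
(* The condition on [c] says that the drift [r - delta - c + lam - Ip] is nonnegative. *)
have Phi_cvg c : c <= lam + (r - delta - Ip) -> t^-1 * Phi c t @[t --> 0^'+] --> lam.
  by move=> cd; apply: (levy_put_small_time levyX) => //; rewrite -/lam -/Ip; lra.
(* The price depends on calendar time only through [T - t], so [euro_crit] at [t] is convertible to
   [crit (T - t)]. *)
pose crit t := inf [set x : R | 0 <= x /\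
  posp (K - x) < \int[P]_w (expR (- r * t) *
    posp (K - x * expR ((r - delta) * t + X t w)))].
suff H : (K / crit t - 1) / t @[t --> 0^'+] --> lam.
  exact: (cvg_comp _ _ (@cvg_left_sub R T) H).
apply/cvgrPdist_le => e e0.
(* The term [lam / 2] keeps [c1] positive; half of [d_+] in [c2] keeps the drift nonnegative, which
   is where [d_+ > 0] enters. *)
pose c1 := Num.max (lam / 2) (lam - e).
pose c2 := lam + Num.min ((r - delta - Ip) / 2) (e / 2).
have c1_lt : c1 < lam by rewrite gt_max; apply/andP; split; lra.
have c1_ge : lam - e <= c1 by rewrite le_max lexx orbT.
have c1_gt0 : 0 < c1 by rewrite lt_max; apply/orP; left; lra.
have c2_gt : lam < c2 by rewrite ltrDl lt_min; apply/andP; split; lra.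
have c2_le : c2 <= lam + e / 2 by rewrite lerD2l ge_min lexx orbT.
have c2_le' : c2 <= lam + (r - delta - Ip) / 2 by rewrite lerD2l ge_min lexx.
have Phi1 : t^-1 * Phi c1 t @[t --> 0^'+] --> lam by apply: Phi_cvg; lra.
have Phi2 : t^-1 * Phi c2 t @[t --> 0^'+] --> lam by apply: Phi_cvg; lra.
have disc : expR (- r * t) * (t^-1 * Phi c1 t) @[t --> 0^'+] --> lam.
  rewrite -[X in _ --> X]mul1r; apply: cvgM; last exact: Phi1.
  have -> : (1 : R) = expR (- r * 0) by rewrite mulr0 expR0.
  apply: (@cvg_at_right_filter _ _ (fun t => expR (- r * t))).
  apply: (@continuous_comp _ _ _ (fun t => - r * t) expR); last exact: continuous_expR.
  by apply: cvgM; [exact: cvg_cst|exact: cvg_id].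
have E2 : (1 - expR (- (c2 * t))) / t @[t --> 0^'+] --> c2.
  apply: is_derive0_cvg_right.
    by apply: is_derive_eq; rewrite mulr0 oppr0 expR0 /GRing.scale/=; ring.
  by rewrite mulr0 oppr0 expR0 subrr.
have E3 : (expR (c2 * t) - 1) / t @[t --> 0^'+] --> c2.
  apply: is_derive0_cvg_right.
    by apply: is_derive_eq; rewrite mulr0 expR0 /GRing.scale/=; ring.
  by rewrite mulr0 expR0 subrr.
near=> t.
have t0 : 0 < t by near: t; exact: nbhs_right_gt.
have tV : 0 < t^-1 by rewrite invr_gt0.
have [mX _] := charX t (ltW t0).
pose W w := (r - delta) * t + X t w.
have mW : measurable_fun setT W by rewrite /W; measurability.
have D01 : 0 < expR (- r * t) <= 1.
  by rewrite expR_gt0/= -expR0 ler_expR mulNr oppr_le0 mulr_ge0// ltW.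
have PhiE c : Phi c t = \int[P]_w put_payoff (W w - c * t).
  by apply: eq_Rintegral => w _; congr put_payoff; rewrite /W; ring.
have A1 : c1 < expR (- r * t) * (t^-1 * Phi c1 t).
  by near: t; exact: (cvgr_gt _ disc).
(* The two sides tend to [lam] and [c2], which the midpoint separates. *)
have A2 : t^-1 * Phi c2 t <= (1 - expR (- (c2 * t))) / t.
  apply: (@le_trans _ _ ((lam + c2) / 2)); apply: ltW.
    by near: t; apply: (cvgr_lt _ Phi2); lra.
  by near: t; apply: (cvgr_gt _ E2); lra.
have A3 : (expR (c2 * t) - 1) / t <= lam + e.
  apply: ltW; near: t; apply: (cvgr_lt _ E3); lra.
have bounds : K * expR (- (c2 * t)) <= crit t <= K * expR (- (c1 * t)).
  apply: (critical_price_exp_bounds mW K0 D01); rewrite -?PhiE.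
  - exact: mulr_gt0.
  - by rewrite -ltr_pdivlMr// mulrC mulrCA.
  - by move: A2; rewrite mulrC ler_pM2r.
have /andP[B1 B2] := critical_price_sandwich K0 t0 bounds.
by rewrite ler_distlC (le_trans c1_ge B1) (le_trans B2 A3).
Unshelve. all: by end_near. Qed.

Unset Implicit Arguments.

Theorem theorem5p1 (R : realType) (d : measure_display) (Omega : measurableType d)
  (P : probability Omega R) (X : R -> Omega -> R) (sigma gamma : R)
  (nu : {measure set (measurableTypeR R) -> \bar R})
  (T K r delta : R) :
  levy_process P X sigma gamma nu ->
  0 < T -> 0 < K -> 0 < r -> 0 <= delta ->
  (* exponential moment: int_{|x|>=1} e^x nu(dx) < oo *)
  (\int[nu]_(x in [set x : measurableTypeR R | (1 <= `|x|)%R]) (expR x)%:E < +oo)%E ->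
  (* martingale condition *)
  sigma ^+ 2 / 2 + gamma
    + \int[nu]_(x in setT) (expR x - 1 - (if `|x| <= 1 then x else 0)) = 0 ->
  (* non-degeneracy *)
  (sigma != 0 \/ (0 < nu [set x : measurableTypeR R | (x < 0)%R])%E \/
   (\int[nu]_(x in [set x : measurableTypeR R | (0 < x)%R]) (Num.min x 1)%R%:E = +oo)%E) ->
  (* finite variation *)
  sigma = 0 ->
  (\int[nu]_(x in [set x : measurableTypeR R | (`|x| <= 1)%R]) (`|x|)%:E < +oo)%E ->
  (* d_+ > 0 *)
  0 < r - delta - \int[nu]_(y in setT) posp (expR y - 1) ->
  (fun t => (K / euro_crit P X T K r delta t - 1) / (T - t)) @ T^'-
    --> \int[nu]_(y in setT) negp (expR y - 1).
Proof.
move=> levyX T0 K0 r0 _ exp_moment martingale nondeg sigma0 finvar dplus.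
subst sigma.
have [[nu0 intnu] _] := levyX.
(* The integrable function [min(x^2, 1)] is positive off the null set [{0}]; sigma-finiteness is
   what Fubini requires. *)
have sfnu : sigma_finite setT nu.
  apply: (@integrable_pos_sigma_finite _ _ _ nu
    (fun x : measurableTypeR R => Num.min (x ^+ 2) 1) [set 0]) => //.
  - by move=> x; rewrite le_min sqr_ge0/=.
  - move=> x /= /eqP x0; rewrite lt_min ltr01 andbT.
    by rewrite lt_neqAle sqr_ge0 andbT eq_sym sqrf_eq0.
(* The same measure, repackaged with its sigma-finite structure. *)
pose nu' : {sigma_finite_measure set (measurableTypeR R) -> \bar R} :=
  HB.pack_for (SigmaFiniteMeasure.type (measurableTypeR R) R) (Measure.sort nu)
    (isSigmaFinite.Build _ _ _ _ sfnu)
    (isSFinite.Build _ _ _ _ (sfinite_measure_sigma_finite sfnu)).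
have nuE : nu = nu' by exact: eq_measure.
move: levyX exp_moment martingale nondeg finvar dplus; rewrite nuE.
move=> levyX exp_moment martingale nondeg finvar dplus.
apply: (@sigma_finite_euro_crit_cvg _ _ _ _ _ gamma) => //.
  by move: martingale; rewrite expr0n/= mul0r add0r.
by case: nondeg => // /eqP.
Qed.
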